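(* Let $p\ge1$, let $(X,d,\mathfrak m)$ be a doubling metric measure space and let $x,y\in X$. Then the (mutually equivalent) conditions (i) there exist $C>0$ and $L\ge1$ such that for every $u\in\mathrm{Lip}(X)$: $|u(x)-u(y)|^p\le C\,d(x,y)^{p-1}\int(\mathrm{lip}\,u)^p\,d\mathfrak m^L_{x,y}$; (ii) there exist $C>0$ and $L\ge1$ such that for every Borel $g:X\to[0,+\infty]$ with $g(x),g(y)<+\infty$: $$\lim_{\varepsilon\to0}\ \inf_{\substack{c\in\mathscr C^\varepsilon_{x,y}\\ \ell(c)\le C d(x,y)}}\Big(\int_c g\Big)^p\le C\,d(x,y)^{p-1}\int g^p\,d\mathfrak m^L_{x,y};$$ (iii) there exist $C>0$ and $L\ge1$ such that $|u(x)-u(y)|^p\le C\,d(x,y)^{p-1}\int g^p\,d\mathfrak m^L_{x,y}$ for every Borel $u:X\to\mathbb R$, every $\varepsilon>0$ and every $g\in\mathrm{UG}^\varepsilon(u)$ with $g(x),g(y)<+\infty$; are equivalent to the following: there exist $c>0$ and $L\ge1$ such that $$\lim_{\varepsilon\to0}\mathscr C\text{-}\mathrm{Mod}^\varepsilon_p(\mathscr C_{x,y},\mathcal F_{x,y},\mathfrak m^L_{x,y})=\lim_{\varepsilon\to0}\mathscr C\text{-}\mathrm{Mod}^\varepsilon_p(\mathscr C_{x,y},\mathrm{Lip}(X),\mathfrak m^L_{x,y})\ge c\,d(x,y)^{1-p}.$$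
   Context: A metric measure space $(X,d,\mathfrak m)$ is a separable metric space $(X,d)$ (not necessarily complete) with a non-trivial outer measure $\mathfrak m$ which is Radon and finite on bounded sets. It is doubling if there is $C_D\ge1$ with $\mathfrak m(B_{2r}(x))\le C_D\,\mathfrak m(B_r(x))$ for all $x\in X$, $r>0$. $\mathrm{Lip}(X)$ is the set of Lipschitz functions $X\to\mathbb R$ and $\mathrm{lip}\,u(z):=\lim_{\varepsilon\to0}\sup_{w\in B_\varepsilon(z),\,w\ne z}\frac{|u(w)-u(z)|}{d(z,w)}$ (equal to $0$ at isolated points). For $\varepsilon>0$, an $\varepsilon$-chain is a finite sequence of points $c=\{q_i\}_{i=0}^N$ of $X$ with $d(q_i,q_{i+1})\le\varepsilon$ for all $i$; $\alpha(c)=q_0$, $\omega(c)=q_N$, $\ell(c)=\sum_{i=0}^{N-1}d(q_i,q_{i+1})$. $\mathscr C^\varepsilon$ is the set of $\varepsilon$-chains, $\mathscr C=\bigcup_{\varepsilon>0}\mathscr C^\varepsilon$, $\mathscr C_{x,y}=\{c\in\mathscr C:\alpha(c)=x,\omega(c)=y\}$, $\mathscr C^\varepsilon_{x,y}=\mathscr C_{x,y}\cap\mathscr C^\varepsilon$. For $g:X\to[0,+\infty]$, $\int_c g:=\sum_{i=0}^{N-1}\frac{g(q_i)+g(q_{i+1})}{2}d(q_i,q_{i+1})$ (with $0\cdot\infty=0$). A Borel function $g:X\to[0,+\infty]$ belongs to $\mathrm{UG}^\varepsilon(u)$ if $|u(\omega(c))-u(\alpha(c))|\le\int_c g$ for every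 $\varepsilon$-chain $c$. The infimum over the empty set is $+\infty$. For a family of chains $\mathsf C\subseteq\mathscr C$, a family $\mathcal F$ of Borel functions on $X$ and a measure $\mu$ on $X$, $$\mathscr C\text{-}\mathrm{Mod}^\varepsilon_p(\mathsf C,\mathcal F,\mu):=\inf\Big\{\int\rho^p\,d\mu:\rho\in\mathcal F,\ \rho\ge0\text{ Borel},\ \int_c\rho\ge1\text{ for every }c\in\mathsf C\cap\mathscr C^\varepsilon\Big\}.$$ $\mathcal F_{x,y}$ is the family of Borel functions $g:X\to[0,+\infty]$ with $g(x),g(y)<+\infty$. For $x,y\in X$, $L\ge1$, let $B^L_{x,y}=B_{Ld(x,y)}(x)\cup B_{Ld(x,y)}(y)$ and $$R^L_{x,y}(z):=\Big(\frac{d(x,z)}{\mathfrak m(B_{d(x,z)}(x))}+\frac{d(y,z)}{\mathfrak m(B_{d(y,z)}(y))}\Big)\chi_{B^L_{x,y}}(z),\qquad R^L_{x,y}(x)=R^L_{x,y}(y)=0,$$ and $\mathfrak m^L_{x,y}:=R^L_{x,y}\,\mathfrak m$. *)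

(* Defs.v *)
From HB Require Import structures.
From mathcomp Require Export all_boot all_order all_algebra.
From mathcomp Require Export all_classical all_reals all_analysis measurable_realfun.
Export numFieldNormedType.Exports.
Set Implicit Arguments.
Unset Strict Implicit.
Unset Printing Implicit Defensive.
Import Order.TTheory GRing.Theory Num.Theory.

Local Open Scope classical_set_scope.
Local Open Scope ring_scope.
Local Open Scope ereal_scope.

(* The library's measurable types carry a distinguished point, so the metric
   spaces used here do too; this only says that they are nonempty. *)
#[short(type="pmetricType")]
HB.structure Definition PointedMetric (R : numDomainType) :=
  {X of Metric R X & isPointed X}.

Section MetricMeasureSpace.
Context {R : realType} {X : pmetricType R}.
Implicit Types (m : set X -> \bar R) (A : set X) (x y z : X) (r : R).

Local Notation borelType := (g_sigma_algebraType (@open X)).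

Definition borel_set A : Prop := <<s @open X>> A.

Definition borel_fun (g : X -> \bar R) : Prop :=
  measurable_fun setT (g : borelType -> \bar R).

Definition borel_rfun (u : X -> R) : Prop :=
  measurable_fun setT (u : borelType -> R).

(* Integration over Borel sets: the library's integral against the values of
   [m] on the Borel sigma-algebra. *)
Definition bintegral m A (f : X -> \bar R) : \bar R :=
  integral (m : set borelType -> \bar R) A f.

(* Radon outer measures in the sense of Federer, 2.2.5 *)
Record radon m : Prop := Radon {
  radon_borel : forall A, borel_set A -> m.-caratheodory A ;
  radon_compact : forall K, compact K -> m K < +oo ;
  radon_inner : forall U, open U ->
    m U = ereal_sup [set m K | K in [set K | compact K /\ K `<=` U]] ;
  radon_outer : forall A,
    m A = ereal_inf [set m U | U in [set U | open U /\ A `<=` U]] }.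

Definition bounded_subset A : Prop := exists z r, A `<=` ball z r.

Definition separable_space : Prop := exists2 D : set X, countable D & dense D.

Record metric_measure_space (m : {outer_measure set X -> \bar R}%R) : Prop :=
  MetricMeasureSpace {
    mms_separable : separable_space ;
    mms_nontrivial : m setT != 0 ;
    mms_radon : radon m ;
    mms_bounded : forall A, bounded_subset A -> m A < +oo }.

Definition doubling m : Prop :=
  exists CD : R, (1 <= CD)%R /\
    forall x r, (0 < r)%R -> m (ball x (2 * r)%R) <= CD%:E * m (ball x r).

Definition Lipschitz (u : X -> R) : Prop :=
  exists K : R, forall a b, (`|u a - u b| <= K * mdist a b)%R.

(* The supremum is monotone in [e], so the limit exists in \bar R; likewise for
   limits at 0^'+ of [chain_mod] and of infima over [eps_chains]. *)
Definition lip (u : X -> R) (z : X) : \bar R :=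
  if `[< isolated [set: X] z >] then 0 else
  lim ((fun e : R => ereal_sup [set (`|u w - u z| / mdist z w)%:E |
                       w in [set w | ball z e w /\ w <> z]]) @ 0^'+).

(* The chain q_0, ..., q_N is encoded as (q_0, [:: q_1; ...; q_N]). *)
Definition chain : Type := (X * seq X)%type.

Implicit Type c : chain.

Definition chain_size c : nat := size c.2.
Definition chain_nth c (i : nat) : X := nth c.1 (c.1 :: c.2) i.
Definition chain_start c : X := chain_nth c 0.
Definition chain_end c : X := chain_nth c (chain_size c).

Definition chain_length c : R :=
  (\sum_(i < chain_size c) mdist (chain_nth c i) (chain_nth c i.+1))%R.

Definition eps_chains (e : R) : set chain :=
  [set c | forall i, (i < chain_size c)%N ->
     (mdist (chain_nth c i) (chain_nth c i.+1) <= e)%R].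

Definition chains : set chain :=
  \bigcup_(e in [set e : R | (0 < e)%R]) eps_chains e.

Definition chains_from_to x y : set chain :=
  [set c | [/\ chains c, chain_start c = x & chain_end c = y]].

(* In the library 0 * +oo = 0. *)
Definition chain_integral (g : X -> \bar R) c : \bar R :=
  \sum_(i < chain_size c)
    (g (chain_nth c i) + g (chain_nth c i.+1)) * (2^-1)%:E *
    (mdist (chain_nth c i) (chain_nth c i.+1))%:E.

Definition upper_gradient (e : R) (u : X -> R) : set (X -> \bar R) :=
  [set g | [/\ borel_fun g, (forall z, 0 <= g z) &
    forall c, eps_chains e c ->
      (`|u (chain_end c) - u (chain_start c)|%R)%:E <= chain_integral g c]].

Definition chain_mod (p e : R) (C : set chain) (F : set (X -> \bar R))
    (mu : set X -> \bar R) : \bar R :=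
  ereal_inf [set bintegral mu setT (fun z => rho z `^ p) |
    rho in [set rho | [/\ F rho, (forall z, 0 <= rho z), borel_fun rho &
      forall c, (C `&` eps_chains e) c -> 1 <= chain_integral rho c]]].

Definition fin_at_borel x y : set (X -> \bar R) :=
  [set g | [/\ borel_fun g, (forall z, 0 <= g z), g x < +oo & g y < +oo]].

Definition Lip_family : set (X -> \bar R) :=
  [set EFin \o u | u in Lipschitz].

Definition riesz_kernel m (L : R) x y (z : X) : \bar R :=
  if (z == x) || (z == y) then 0 else
  ((mdist x z)%:E / m (ball x (mdist x z)) +
   (mdist y z)%:E / m (ball y (mdist y z))) *
  (\1_(ball x (L * mdist x y)%R `|` ball y (L * mdist x y)%R) z)%:E.

(* The set function A |-> \int_A R^L_{x,y} dm, to be used on Borel sets *)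
Definition riesz_measure m (L : R) x y : set X -> \bar R :=
  fun A => bintegral m A (riesz_kernel m L x y).

End MetricMeasureSpace.

(* Main.v *)
Require Import Defs.
From HB Require Import structures.
From mathcomp Require Import ring lra.
Import Order.TTheory GRing.Theory Num.Theory.

(** Fix [x] and [y] and let [mu] be the measure weighted by the Riesz kernel.
    Doubling makes [mu] finite: on the dyadic annulus of radius [r / 2 ^ k]
    around a pole, the kernel is the radius divided by the mass of a comparable
    ball, so the annulus carries at most a multiple of [r / 2 ^ k]
    ([integral_riesz_kernel_lty]). From there on the argument concerns an
    arbitrary finite Borel measure on a metric space.

    The core is [lipschitz_admissible_approx]: a Borel weight that is admissible
    for all [e]-chains from [x] to [y] can be replaced, at arbitrarily small
    cost in energy, by a Lipschitz weight that is admissible at some smaller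
    scale. Instead of passing to limits of chains, one uses that the potential
    [u z], the infimum over [e]-chains from [x] to [z] of the integral of the
    weight [rho], satisfies
    [|u z - u w| <= (rho z + rho w) / 2 * mdist z w] for all points at distance
    at most [e] ([chain_potential]). This is a Hajlasz-type condition: where
    [rho <= t] the potential is Lipschitz, so that it can be restricted to a set
    of almost full measure on which [rho] is bounded and nearly constant at a
    small scale ([lusin_levels]), and extended from there with a slope close to
    [rho] on that set and at most of order [t] elsewhere
    ([lipschitz_extension_slope]). The exceptional part costs about
    [t ^ p] times the measure of [rho > t], which tends to [0].

    The implications follow.
    From (i) to (ii): if all short chains are expensive for [g], then [g] plus a
    suitable constant is admissible up to a factor, and the Lipschitz function
    approximating its potential contradicts (i) ([short_chain_inf_le]).
    From (ii) to (iii): an upper gradient integrates along every fine enough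
    chain.
    From (iii) to the modulus condition: the equality of the two limits is the
    approximation above ([lim_chain_mod_Lip]), and the lower bound results from
    (iii) applied to the potential of a Lipschitz weight
    ([lipschitz_upper_gradient_ge]).
    From the modulus condition to (i): the supremum of the difference quotients
    of [u] at scale [e] is an admissible weight up to the factor [|u x - u y|],
    and decreases to the local Lipschitz constant
    ([lip_inequality_of_chain_mod]). *)

Local Open Scope classical_set_scope.
Local Open Scope ring_scope.

(** * Lipschitz extension with prescribed slope *)

Section MetricExtension.
Context {R : realType} {X : pmetricType R}.
Implicit Types (z w : X) (K : set X).

Lemma inf_fam_le {I : Type} {K : set I} {f : I -> R} k :
  (forall i, K i -> 0 <= f i) -> K k -> inf [set f i | i in K] <= f k.
Proof.
move=> f0 Kk; apply: ge_inf; last by exists k.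
by exists 0 => _ [i Ki <-]; exact: f0.
Qed.

Lemma le_inf_fam {I : Type} {K : set I} {f : I -> R} c :
  K !=set0 -> (forall i, K i -> c <= f i) -> c <= inf [set f i | i in K].
Proof.
move=> [k Kk] cf; apply: lb_le_inf; first by exists (f k), k.
by move=> _ [i Ki <-]; exact: cf.
Qed.

Lemma inf_fam_lipschitz {I : Type} {K : set I} {f : I -> X -> R} {L : R} :
  K !=set0 -> (forall i z, K i -> 0 <= f i z) ->
  (forall i z w, K i -> f i z <= f i w + L * mdist z w) ->
  forall z w, `|inf [set f i z | i in K] - inf [set f i w | i in K]| <=
    L * mdist z w.
Proof.
move=> K0 f0 fL.
suff main z w : inf [set f i z | i in K] - L * mdist z w <=
    inf [set f i w | i in K].
  move=> z w; rewrite ler_norml; have := main z w; have := main w z.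
  by rewrite metric_sym; lra.
apply: le_inf_fam => // i Ki; have := fL i z w Ki.
have := @inf_fam_le _ K (fun i => f i z) i (fun j => f0 j z) Ki; lra.
Qed.

(** Extends [u] from [K] so that its slope at a fixed small scale is close to
    the prescribed weight [a] near [K], and is bounded everywhere. The McShane
    formula with the slope [a k + 3 * eta] attached to each [k] would do if the
    bound by [a] held at all distances; since it only holds below [s], the cone
    at [k] is replaced by one that becomes steep, with slope [L], before the
    distance [s]. The margin [2 * eta] between the cone and the oscillation of
    [u] makes cones with a distant apex irrelevant near [K], so that only
    weights close to the local value of [a] are seen there. The steep slope
    depends on [t] and [eta] and not on [s]: this is what allows [K], and hence
    [s], to be chosen after [t]. *)
Lemma lipschitz_extension_slope K (u a : X -> R) (t eta s : R) :
  K !=set0 -> 0 < eta -> 0 < s -> 0 <= t ->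
  (forall k, K k -> 0 <= u k) -> (forall k, K k -> 0 <= a k <= t) ->
  (forall k k', K k -> K k' -> `|u k - u k'| <= t * mdist k k') ->
  (forall k k', K k -> K k' -> mdist k k' < s ->
     `|u k - u k'| <= (a k + eta) * mdist k k' /\ a k' <= a k + eta) ->
  exists (v h : X -> R) (e : R),
    [/\ Lipschitz v, Lipschitz h, 0 < e &
     [/\ forall k, K k -> v k = u k,
         forall z, 0 <= h z <= 2 * (t + 3 * eta),
         forall k, K k -> h k <= a k + 5 * eta &
         forall z w, mdist z w <= e -> `|v z - v w| <= h z * mdist z w]].
Proof.
move=> K0 eta0 s0 t0 u0 at_ ut ua.
set L := 2 * (t + 3 * eta).
have L0 : 0 < L by rewrite /L; lra.
pose phi k (x : R) := Num.max ((a k + 3 * eta) * x) (L * (x - s / 2)).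
have phi_lip k x x' e : K k -> 0 <= e -> x <= x' + e ->
    phi k x <= phi k x' + L * e.
  move=> Kk e0 xx'; have /andP[a0 ak] := at_ k Kk.
  have h1 : (a k + 3 * eta) * x' <= phi k x' by rewrite le_max lexx.
  have h2 : L * (x' - s / 2) <= phi k x' by rewrite le_max lexx orbT.
  have h3 : (a k + 3 * eta) * x <= (a k + 3 * eta) * (x' + e).
    by rewrite ler_wpM2l//; lra.
  have h4 : (a k + 3 * eta) * e <= L * e by rewrite ler_wpM2r// /L; lra.
  have h5 : L * x <= L * (x' + e) by rewrite ler_pM2l.
  rewrite mulrDr in h3; rewrite !(mulrDr L) in h2 h5.
  by rewrite {1}/phi ge_max (mulrDr L); apply/andP; split; lra.
have phi_lin k x : K k -> 0 <= x -> x <= s / 2 -> phi k x = (a k + 3 * eta) * x.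
  move=> Kk x0 xs; have /andP[a0 ak] := at_ k Kk.
  apply/max_idPl; apply: (@le_trans _ _ 0).
    by rewrite pmulr_rle0//; lra.
  by rewrite mulr_ge0//; lra.
have phi_ge k x : K k -> (a k + 3 * eta) * x <= phi k x.
  by move=> Kk; rewrite le_max lexx.
have phi_ge0 k x : K k -> 0 <= x -> 0 <= phi k x.
  move=> Kk x0; have /andP[a0 ak] := at_ k Kk.
  by apply: le_trans (phi_ge _ _ Kk); rewrite mulr_ge0//; lra.
have phi_u k k' : K k -> K k' ->
    u k' + 2 * eta * mdist k k' <= u k + phi k (mdist k k').
  move=> Kk Kk'; set d := mdist k k'; have d0 : 0 <= d by exact: mdist_ge0.
  have [ds|sd] := ltP d s.
    have [+ _] := ua _ _ Kk Kk' ds; rewrite -/d ler_norml => /andP[+ _].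
    have := phi_ge k d Kk; rewrite !mulrDl; lra.
  have : L * (d - s / 2) <= phi k d by rewrite le_max lexx orbT.
  have : L * (d / 2) <= L * (d - s / 2) by rewrite ler_pM2l//; lra.
  have := ut _ _ Kk Kk'; rewrite -/d ler_norml => /andP[+ _].
  by have := mulr_ge0 (ltW eta0) d0; rewrite /L !mulrDl; lra.
pose f k z := u k + phi k (mdist z k).
pose v z := inf [set f k z | k in K].
have f0 k z : K k -> 0 <= f k z.
  by move=> Kk; rewrite addr_ge0 ?u0 ?phi_ge0// mdist_ge0.
have v_le k z : K k -> v z <= f k z.
  by move=> Kk; apply: (@inf_fam_le _ K (fun k => f k z)) => // i; exact: f0.
have vL z w : `|v z - v w| <= L * mdist z w.
  apply: inf_fam_lipschitz => // i z' w' Ki; rewrite /f -addrA lerD2l.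
  apply: phi_lip => //; first exact: mdist_ge0.
  by have := metric_triangle z' w' i; lra.
have vu k : K k -> v k = u k.
  move=> Kk; apply/eqP; rewrite eq_le; apply/andP; split.
    rewrite (le_trans (v_le k k Kk))// /f mdistxx phi_lin//; last by lra.
    by rewrite mulr0 addr0.
  apply: le_inf_fam => // i Ki; have := phi_u i k Ki Kk.
  have : 0 <= 2 * eta * mdist i k by rewrite mulr_ge0 ?mdist_ge0//; lra.
  by rewrite /f (metric_sym k i); lra.
(* the largest radius for which the estimate [far] below closes *)
pose dlt := eta * s / (4 * (L + eta)).
have Le0 : 0 < 4 * (L + eta) by rewrite pmulr_rgt0//; lra.
have dlt0 : 0 < dlt by rewrite /dlt divr_gt0// mulr_gt0.
have dltE : 4 * (L * dlt) + 4 * (eta * dlt) = eta * s.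
  rewrite /dlt; field; apply/eqP; lra.
have dlts : dlt <= s / 8.
  rewrite /dlt ler_pdivrMr//.
  have := mulr_gt0 s0 eta0; have := mulr_ge0 (ltW s0) t0; rewrite /L; lra.
(* a far competitor does no better than a point of [K] close to [z] *)
have far k k0 z : K k -> K k0 -> mdist z k0 <= dlt -> s / 4 <= mdist z k ->
    f k0 z <= f k z.
  move=> Kk Kk0 zk0 zk.
  have h1 : phi k (mdist k k0) <= phi k (mdist z k) + L * dlt.
    apply: phi_lip => //; first exact: ltW.
    by have := metric_triangle k z k0; rewrite (metric_sym k z); lra.
  have h2 : phi k0 (mdist z k0) <= phi k0 0 + L * dlt.
    by apply: phi_lip => //; [exact: ltW|lra].
  rewrite (phi_lin k0 0)// in h2; last by lra.
  have h3 := phi_u _ _ Kk Kk0.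
  have h4 : eta * (s / 4 - dlt) <= eta * mdist k k0.
    rewrite ler_pM2l//.
    by have := metric_triangle z k0 k; rewrite (metric_sym k0 k); lra.
  by rewrite /f; lra.
have slope k0 z w : K k0 -> mdist z k0 <= dlt -> mdist w k0 <= dlt ->
    v w - (a k0 + 4 * eta) * mdist z w <= v z.
  move=> Kk0 zk0 wk0; have zw0 := mdist_ge0 z w.
  have near k : K k -> mdist z k < s / 4 ->
      v w - (a k0 + 4 * eta) * mdist z w <= f k z.
    move=> Kk zk; have zk_0 := mdist_ge0 z k.
    have wz : mdist w z <= 2 * dlt.
      by have := metric_triangle w k0 z; rewrite (metric_sym k0 z); lra.
    have wk : mdist w k <= mdist z k + mdist z w.
      by have := metric_triangle w z k; rewrite (metric_sym w z); lra.
    rewrite (metric_sym w z) in wz.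
    have /andP[a0 _] := at_ k Kk.
    have vw := v_le k w Kk.
    rewrite /f !phi_lin ?mdist_ge0// in vw *; [|lra..].
    have k0k : mdist k0 k < s.
      by have := metric_triangle k0 z k; rewrite (metric_sym k0 z); lra.
    have [_ ak] := ua _ _ Kk0 Kk k0k.
    have : (a k + 3 * eta) * mdist w k <=
           (a k + 3 * eta) * (mdist z k + mdist z w) by rewrite ler_wpM2l//; lra.
    have : (a k + 3 * eta) * mdist z w <= (a k0 + 4 * eta) * mdist z w.
      by rewrite ler_wpM2r//; lra.
    by rewrite (mulrDr (a k + 3 * eta)); lra.
  apply: le_inf_fam => // k Kk; have [/near|zk] := ltP (mdist z k) (s / 4).
    exact.
  apply: le_trans (far k k0 z Kk Kk0 zk0 zk); apply: near => //; lra.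
(* [h] reaches its cap [L] already at distance [dlt / 2] from [K] *)
pose M := 2 * L / dlt.
have M0 : 0 < M by rewrite /M divr_gt0//; lra.
pose g k z := Num.min L (a k + 5 * eta + M * mdist z k).
pose h z := inf [set g k z | k in K].
have g0 k z : K k -> 0 <= g k z.
  move=> Kk; have /andP[a0 _] := at_ k Kk.
  have Mzk : 0 <= M * mdist z k by rewrite mulr_ge0 ?mdist_ge0// ltW.
  by rewrite /g le_min (ltW L0)/=; lra.
have h_le k z : K k -> h z <= g k z.
  by move=> Kk; apply: (@inf_fam_le _ K (fun k => g k z)) => // i; exact: g0.
exists v, h, (dlt / 2); split.
- by exists L.
- exists M; apply: inf_fam_lipschitz => // k z w Kk.
  have := mdist_ge0 z w => zw0.
  have Mzw : 0 <= M * mdist z w by rewrite mulr_ge0//; lra.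
  have : M * mdist z k <= M * (mdist z w + mdist w k).
    by rewrite ler_pM2l// metric_triangle.
  rewrite mulrDr => Mzk.
  by rewrite /g ge_min; have [|] := leP L (a k + 5 * eta + M * mdist w k) => ?;
    apply/orP; [left|right]; lra.
- lra.
- split => //.
  + move=> z; apply/andP; split.
      by apply: le_inf_fam => // k; exact: g0.
    have [k Kk] := K0; apply: le_trans (h_le k z Kk) _.
    by rewrite ge_min lexx.
  + move=> k Kk; apply: le_trans (h_le k k Kk) _.
    by rewrite ge_min mdistxx mulr0 addr0 lexx orbT.
  + move=> z w zw.
    have [->|zNw] := eqVneq z w; first by rewrite subrr normr0 mdistxx mulr0.
    have zw0 : 0 < mdist z w by rewrite mdist_gt0.
    rewrite -ler_pdivrMr//; apply: le_inf_fam => // k Kk.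
    rewrite /g le_min !ler_pdivrMr// vL/=.
    have [zk|zk] := leP (mdist z k) (dlt / 2); last first.
      apply: le_trans (vL z w) _; rewrite ler_wpM2r ?(ltW zw0)//.
      have /andP[a0 _] := at_ k Kk.
      have : M * (dlt / 2) <= M * mdist z k by rewrite ler_pM2l// ltW.
      have -> : M * (dlt / 2) = L by rewrite /M; field; apply/eqP; lra.
      lra.
    have wk : mdist w k <= dlt.
      by have := metric_triangle w z k; rewrite (metric_sym w z); lra.
    have zk' : mdist z k <= dlt by lra.
    have h1 := slope k z w Kk zk' wk.
    have h2 := slope k w z Kk wk zk'; rewrite (metric_sym w z) in h2.
    apply: (@le_trans _ _ ((a k + 4 * eta) * mdist z w)).
      by rewrite ler_norml; lra.
    rewrite ler_pM2r//; have : 0 <= M * mdist z k.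
      by rewrite mulr_ge0 ?mdist_ge0// ltW.
    lra.
Qed.
End MetricExtension.

(** * Chains and their potentials *)

Local Open Scope ereal_scope.

Section Chains.
Context {R : realType} {X : pmetricType R}.
Implicit Types (c : @chain R X) (g : X -> \bar R) (z w : X) (e : R).

(** The contribution of a single step to [chain_integral]. *)
Definition trapezoid g z w : \bar R :=
  (g z + g w) * (2^-1)%:E * (mdist z w)%:E.

Lemma trapezoid_sym g z w : trapezoid g z w = trapezoid g w z.
Proof. by rewrite /trapezoid addeC metric_sym. Qed.

Lemma trapezoid_ge0 g z w : (forall z, 0 <= g z) -> 0 <= trapezoid g z w.
Proof.
move=> g0; rewrite /trapezoid mule_ge0 ?mule_ge0 ?adde_ge0 ?lee_fin//.
exact: mdist_ge0.
Qed.

Definition chain_rcons c w : @chain R X := (c.1, rcons c.2 w).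

Lemma chain_nth_rcons c w i : (i <= chain_size c)%N ->
  chain_nth (chain_rcons c w) i = chain_nth c i.
Proof.
by move=> ic; rewrite /chain_nth/= -rcons_cons nth_rcons ltnS ic.
Qed.

Lemma chain_end_rcons c w : chain_end (chain_rcons c w) = w.
Proof.
rewrite /chain_end /chain_nth /chain_size/= size_rcons/=.
by rewrite nth_rcons ltnn eqxx.
Qed.

Lemma chain_integral_rcons g c w : chain_integral g (chain_rcons c w) =
  chain_integral g c + trapezoid g (chain_end c) w.
Proof.
rewrite /chain_integral /chain_size/= size_rcons big_ord_recr/=; congr (_ + _).
  by apply: eq_bigr => i _; rewrite !chain_nth_rcons ?ltn_ord// ltnW ?ltn_ord.
rewrite /trapezoid chain_nth_rcons//; have := chain_end_rcons c w.
by rewrite /chain_end {1}/chain_size/= size_rcons => ->.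
Qed.

Lemma eps_chain_rcons e c w : eps_chains e c ->
  (mdist (chain_end c) w <= e)%R -> eps_chains e (chain_rcons c w).
Proof.
move=> ce zw i; rewrite /chain_size/= size_rcons ltnS leq_eqVlt => /predU1P[->|ic].
  rewrite chain_nth_rcons//; have := chain_end_rcons c w.
  by rewrite /chain_end {1}/chain_size/= size_rcons => ->.
by rewrite !chain_nth_rcons//; [exact: ce|exact: ltnW].
Qed.

Lemma chain_integral_ge0 g c : (forall z, 0 <= g z) -> 0 <= chain_integral g c.
Proof. by move=> g0; apply: sume_ge0 => i _; exact: trapezoid_ge0. Qed.

Lemma le_chain_integral_of_step (v : X -> R) g e c :
  (forall z w, (mdist z w <= e)%R -> `|v z - v w|%:E <= trapezoid g z w) ->
  eps_chains e c ->
  `|v (chain_end c) - v (chain_start c)|%:E <= chain_integral g c.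
Proof.
move=> vg ce; pose q i := v (chain_nth c i).
have -> : (v (chain_end c) - v (chain_start c) =
    \sum_(0 <= i < chain_size c) (q i.+1 - q i))%R.
  by rewrite telescope_sumr.
rewrite big_mkord; apply: (@le_trans _ _
    (\sum_(i < chain_size c) `|q i.+1 - q i|%:E)).
  by rewrite sumEFin lee_fin ler_norm_sum.
apply: lee_sum => i _; rewrite distrC.
by apply: vg; apply: ce; exact: ltn_ord.
Qed.

Lemma eps_chain_chains e : (0 < e)%R -> @eps_chains R X e `<=` chains.
Proof. by move=> e0 c ce; exists e. Qed.

(** The potential is the infimum of the integrals of [g] over the chains
    issued from [x], truncated at [1]. Appending one step to a chain bounds its
    increment for every pair of points at distance at most [e], not only along
    rectifiable curves: this is the gain of working with chains. *)
Lemma chain_potential e x y g : (0 < e)%R -> (forall z, 0 <= g z) ->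
  (forall c, (chains_from_to x y `&` eps_chains e) c -> 1 <= chain_integral g c) ->
  exists u : X -> R, [/\ forall z, (0 <= u z <= 1)%R, u x = 0%R, u y = 1%R &
    forall z w, (mdist z w <= e)%R -> `|u z - u w|%:E <= trapezoid g z w].
Proof.
move=> e0 g0 gxy.
pose U z := mine 1 (ereal_inf [set chain_integral g c | c in
  chains_from_to x z `&` eps_chains e]).
have U0 z : 0 <= U z.
  rewrite /U le_min lee01/=; apply: le_ereal_inf_tmp => _ [c _ <-].
  exact: chain_integral_ge0.
have U1 z : U z <= 1 by rewrite /U ge_min lexx.
have Ufin z : U z \is a fin_num.
  by rewrite ge0_fin_numE// (le_lt_trans (U1 z))// ltry.
have Ustep z w : (mdist z w <= e)%R -> U w <= U z + trapezoid g z w.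
  move=> zw; have [->|] := eqVneq (trapezoid g z w) +oo.
    by rewrite addeC addye ?leey// -ltNye (lt_le_trans _ (U0 z)).
  rewrite -ltey -ge0_fin_numE ?trapezoid_ge0// => tfin.
  rewrite -leeBlDr// {2}/U le_min; apply/andP; split.
    by rewrite leeBlDr// (le_trans (U1 w))// leeDl// trapezoid_ge0.
  apply: le_ereal_inf_tmp => _ [c [[cc cx cz] ce] <-].
  rewrite leeBlDr// -cz -chain_integral_rcons /U ge_min; apply/orP; right.
  have rce : eps_chains e (chain_rcons c w).
    by apply: eps_chain_rcons => //; rewrite cz.
  apply: ereal_inf_lbound; exists (chain_rcons c w) => //; split => //; split.
  - exact: eps_chain_chains rce.
  - by rewrite /chain_start chain_nth_rcons.
  - exact: chain_end_rcons.
exists (fine \o U); split.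
- by move=> z /=; rewrite -!lee_fin fineK// U0 U1.
- suff /= -> : U x = 0 by [].
  apply/eqP; rewrite eq_le U0 andbT /U ge_min; apply/orP; right.
  apply: ereal_inf_lbound; exists (x, [::]).
    by do 2?split => //; exists e.
  by rewrite /chain_integral big_ord0.
- suff /= -> : U y = 1 by [].
  apply/eqP; rewrite eq_le U1/= /U le_min lexx/=.
  by apply: le_ereal_inf_tmp => _ [c cxy <-]; exact: gxy.
- move=> z w zw /=; have [->|] := eqVneq (trapezoid g z w) +oo.
    by rewrite leey.
  rewrite -ltey -ge0_fin_numE ?trapezoid_ge0// => tfin.
  have := Ustep z w zw; rewrite metric_sym in zw; have := Ustep w z zw.
  rewrite trapezoid_sym -(fineK tfin) -(fineK (Ufin z)) -(fineK (Ufin w)).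
  rewrite -!EFinD !lee_fin ler_norml; lra.
Qed.

End Chains.

(** * Borel sets are separated from their complement up to small sets *)

Section SeparatedSets.
Context {R : realType} {X : pmetricType R}.
Local Notation borelType := (g_sigma_algebraType (@open X)).
Variable nu : {measure set borelType -> \bar R}.

(** A Borel set and its complement may touch; the property asks that they lie
    at positive distance once a set of small measure is discarded. It is the
    metric substitute for regularity by closed sets: it is visibly symmetric in
    a set and its complement, which makes the induction over the Borel sets
    short, and it gives the uniform scale needed for Lipschitz extensions
    without any compactness. *)
Definition separated_up_to_small (A : set X) : Prop :=
  forall e : R, (0 < e)%R -> exists (K : set borelType) (r : R),
    [/\ measurable K, nu (~` K) < e%:E, (0 < r)%R &
     forall z w, K z -> K w -> A z -> ~ A w -> (r <= mdist z w)%R].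

Hypothesis nu_fin : nu setT < +oo.

Lemma finite_measure_small (F : (set borelType)^nat) (e : R) :
  (forall n, measurable (F n)) -> nonincreasing_seq F ->
  \bigcap_n F n = set0 -> (0 < e)%R -> exists n, nu (F n) < e%:E.
Proof.
move=> mF niF F0 e0.
have F0fin : nu (F 0%N) < +oo.
  by apply: le_lt_trans nu_fin; apply: le_measure; rewrite ?inE//.
have mcap : measurable (\bigcap_n F n) by rewrite F0.
have := nonincreasing_cvg_mu F0fin mF mcap niF.
rewrite F0 measure0 => cF.
have /(_ cF) : nu \o F @ \oo --> 0 -> \forall n \near \oo, nu (F n) < e%:E.
  move=> c; apply: (c [set x | x < e%:E]).
  apply: open_nbhs_nbhs; split; [exact: open_ereal_lt_ereal|by rewrite /= lte_fin].
by move=> [n _ /(_ n (leqnn n))]; exists n.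
Qed.

Lemma separatedC A : separated_up_to_small A -> separated_up_to_small (~` A).
Proof.
move=> sA e /sA[K [r [mK Ke r0 KA]]]; exists K, r; split => // z w Kz Kw Az.
by move/contrapT => Aw; rewrite metric_sym; apply: KA.
Qed.

Lemma separatedU A B : separated_up_to_small A -> separated_up_to_small B ->
  separated_up_to_small (A `|` B).
Proof.
move=> sA sB e e0; have e20 : (0 < e / 2)%R by rewrite divr_gt0.
have [K [r [mK Ke r0 KA]]] := sA _ e20; have [L [s [mL Le s0 LB]]] := sB _ e20.
exists (K `&` L), (Num.min r s); split.
- exact: measurableI.
- rewrite setCI; apply: (le_lt_trans (measureU2 _ (measurableC mK) (measurableC mL))).
  by rewrite [e]splitr EFinD lteD.
- by rewrite lt_min r0.
- move=> z w [Kz Lz] [Kw Lw] ABz ABw; rewrite ge_min; apply/orP.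
  by case: ABz => [Az|Bz]; [left; apply: KA|right; apply: LB] => // ?;
    apply: ABw; (left + right).
Qed.

(** The points of an open set [A] at distance less than [r] from the
    complement form a set that shrinks to the empty set with [r]. *)
Lemma separated_open A : open A -> separated_up_to_small A.
Proof.
move=> oA e e0.
pose inner (r : R) : set borelType := [set z : X | ball z r `<=` A].
have cinner r : open (~` inner r).
  rewrite openE => z /= /existsNP[w /not_implyP[]].
  rewrite ballEmdist/= => zw Aw; apply/nbhs_ballP.
  exists (r - mdist z w)%R; first by rewrite /= subr_gt0.
  move=> z'; rewrite ballEmdist/= => zz' innerz'; apply: Aw; apply: innerz'.
  rewrite ballEmdist/=; have := metric_triangle z' z w.
  by rewrite (metric_sym z' z); lra.
have minner r : measurable (inner r).
  rewrite -[inner r]setCK; apply: measurableC.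
  by apply: sub_sigma_algebra; exact: cinner.
have mA : measurable (A : set borelType) by exact: sub_sigma_algebra.
pose F n : set borelType := A `\` inner (n.+1%:R^-1)%R.
have [n Fn] : exists n, nu (F n) < e%:E.
  apply: finite_measure_small => //.
  - by move=> n; exact: measurableD.
  - move=> m n mn; apply/subsetPset => z [Az nz]; split => // innerz; apply: nz.
    apply: subset_trans innerz; apply: le_ball.
    by rewrite lef_pV2 ?posrE// ler_nat.
  - rewrite -subset0 => z Fz; have [Az _] := Fz 0%N I.
    have : nbhs z A by rewrite openE in oA; exact: oA.
    move=> /nbhs_ballP[r /= r0 zA]; have := near_infty_natSinv_lt (PosNum r0).
    move=> [n _ /(_ n (leqnn n))/= nr]; have [_] := Fz n I; apply.
    by apply: subset_trans zA; apply: le_ball; exact: ltW.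
exists (inner (n.+1%:R^-1)%R `|` ~` A), (n.+1%:R^-1)%R; split => //.
- by apply: measurableU => //; exact: measurableC.
- by rewrite setCU setCK setIC.
- move=> z w [/= innerz|//] _ Az Aw; rewrite leNgt; apply/negP => zw.
  by apply: Aw; apply: innerz; rewrite ballEmdist.
Qed.

(** A countable union differs from a finite one by a set of small measure,
    which may be discarded. *)
Lemma separated_bigcup (A : (set X)^nat) :
  (forall n, borel_set (A n)) -> (forall n, separated_up_to_small (A n)) ->
  separated_up_to_small (\bigcup_n A n).
Proof.
move=> bA sA e e0.
pose U N := \bigcup_(n < N) A n.
have sU N : separated_up_to_small (U N).
  elim: N => [|N IH].
    move=> e' e'0; exists setT, 1%R; rewrite setCT measure0 lte_fin.
    by split => // z w _ _ [].
  by rewrite /U bigcup_mkord big_ord_recr/= -bigcup_mkord; exact: separatedU.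
have mU N : measurable (U N : set borelType).
  by apply: bigcup_measurable => n _; exact: bA.
pose D N : set borelType := (\bigcup_n A n) `\` U N.
have mD N : measurable (D N).
  by apply: measurableD => //; apply: bigcup_measurable => n _; exact: bA.
have e20 : (0 < e / 2)%R by rewrite divr_gt0.
have [N DN] : exists N, nu (D N) < (e / 2)%:E.
  apply: finite_measure_small => //.
    move=> m n mn; apply/subsetPset => z [Az nU]; split => // -[k/= km Ak].
    by apply: nU; exists k => //=; exact: leq_trans mn.
  rewrite -subset0 => z DNz; have [[n _ An] _] := DNz 0%N I.
  by have [_] := DNz n.+1 I; apply; exists n => /=.
have [K [r [mK Ke r0 KU]]] := sU N _ e20.
exists (K `&` ~` D N), r; split => //.
- by apply: measurableI => //; exact: measurableC.
- rewrite setCI setCK; apply: le_lt_trans (measureU2 _ _ _) _ => //.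
    exact: measurableC.
  by rewrite [e]splitr EFinD lteD.
- move=> z w [Kz Dz] [Kw Dw] Az Aw; apply: KU => //.
    by apply: contrapT => nU; apply: Dz.
  by move=> [n _ An]; apply: Aw; exists n.
Qed.

Lemma borel_separated A : borel_set A -> separated_up_to_small A.
Proof.
suff : borel_set `<=` [set A | borel_set A /\ separated_up_to_small A].
  by move=> sub /sub[].
apply: smallest_sub; last first.
  by move=> U oU; split; [exact: sub_sigma_algebra|exact: separated_open].
split.
- split; first exact: (@measurable0 _ borelType).
  exact/separated_open/open0.
- move=> B [bB sB]; rewrite setTD; split; last exact: separatedC.
  exact: (@measurableC _ borelType).
- move=> F bsF; split; last by apply: separated_bigcup => n; have [] := bsF n.
  by apply: (@bigcup_measurable _ borelType) => n _; have [] := bsF n.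
Qed.

End SeparatedSets.

(** * Uniform oscillation bounds for Borel functions *)

Section LusinLevels.
Context {R : realType} {X : pmetricType R}.
Local Notation borelType := (g_sigma_algebraType (@open X)).
Variable nu : {measure set borelType -> \bar R}.
Hypothesis nu_fin : nu setT < +oo.

Lemma separated_finite_family (A : (set X)^nat) (n : nat) (e : R) :
  (0 < e)%R -> (forall i, borel_set (A i)) -> exists (K : set borelType) (r : R),
    [/\ measurable K, nu (~` K) < e%:E, (0 < r)%R &
     forall i z w, (i < n)%N -> K z -> K w -> A i z -> ~ A i w ->
       (r <= mdist z w)%R].
Proof.
move=> + bA; elim: n e => [|n IH] e e0.
  by exists setT, 1%R; rewrite setCT measure0 lte_fin; split.
have e20 : (0 < e / 2)%R by rewrite divr_gt0.
have [K [r [mK Ke r0 KA]]] := IH _ e20.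
have [L [s [mL Le s0 LA]]] := borel_separated nu nu_fin (A n) (bA n) _ e20.
exists (K `&` L), (Num.min r s); split.
- exact: measurableI.
- rewrite setCI; apply: (le_lt_trans (measureU2 _ (measurableC mK) (measurableC mL))).
  by rewrite [e]splitr EFinD lteD.
- by rewrite lt_min r0.
- move=> i z w + [Kz Lz] [Kw Lw] Az Aw; rewrite ge_min ltnS leq_eqVlt.
  move=> /predU1P[iE|ilt]; apply/orP; [right|left]; last exact: KA Az Aw.
  by rewrite iE in Az Aw; exact: LA.
Qed.

(** A substitute for Lusin's theorem: off a small set, a Borel function
    oscillates by at most [eta] at some uniform scale [r]. It follows by
    separating the finitely many sublevel sets at the multiples of [eta] up to
    [t]; two points below distance [r] lie in the same ones. *)
Lemma lusin_levels (rho : X -> \bar R) (t eta e : R) :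
  borel_fun rho -> (forall z, 0 <= rho z) -> (0 < eta)%R -> (0 < e)%R ->
  exists (K : set borelType) (r : R),
    [/\ measurable K, nu ([set z | rho z <= t%:E] `\` K) < e%:E, (0 < r)%R,
     forall z, K z -> rho z <= t%:E &
     forall z w, K z -> K w -> (mdist z w < r)%R ->
       (fine (rho w) <= fine (rho z) + eta)%R].
Proof.
move=> mrho rho0 eta0 e0.
pose A (i : nat) : set X := [set z | rho z <= (i%:R * eta)%:E].
have mle (s : R) : measurable ([set z | rho z <= s%:E] : set borelType).
  rewrite -[X in measurable X]setTI; exact: emeasurable_fun_infty_c.
have bA i : borel_set (A i) by exact: mle.
pose n := (Num.truncn (t / eta)).+2.
have [K [r [mK Ke r0 KA]]] := separated_finite_family A n e e0 bA.
exists (K `&` [set z | rho z <= t%:E]), r; split => //.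
- exact: measurableI.
- apply: le_lt_trans Ke; apply: le_measure; rewrite ?inE.
  + by apply: measurableD => //; exact: measurableI.
  + exact: measurableC.
  + by move=> z [zt Kz] Kz'; apply: Kz.
- by move=> z [].
- move=> z w [Kz zt] [Kw wt] zw.
  have zfin : rho z \is a fin_num by rewrite ge0_fin_numE// (le_lt_trans zt)// ltry.
  have wfin : rho w \is a fin_num by rewrite ge0_fin_numE// (le_lt_trans wt)// ltry.
  have z0 : (0 <= fine (rho z))%R by rewrite fine_ge0.
  pose j := (Num.truncn (fine (rho z) / eta)).+1.
  have /andP[jl ju] : (j.-1%:R <= fine (rho z) / eta < j%:R)%R.
    by rewrite truncn_itv// divr_ge0// ltW.
  rewrite ler_pdivlMr// in jl; rewrite ltr_pdivrMr// in ju.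
  have jn : (j < n)%N.
    rewrite ltnS ltnS; apply: le_truncn; rewrite ler_pM2r ?invr_gt0//.
    by rewrite -lee_fin fineK.
  have Az : A j z by rewrite /A /= -(fineK zfin) lee_fin ltW.
  have Aw : A j w.
    by apply: contrapT => /(KA j z w jn Kz Kw Az); rewrite leNgt zw.
  move: Aw; rewrite /A/= -(fineK wfin) lee_fin => /le_trans; apply.
  by rewrite /j -natr1 mulrDl mul1r lerD2r.
Qed.
End LusinLevels.

(** * Energy of truncated weights *)

Lemma cvg_powR {R : realType} {T : Type} (F : set_system T) {FF : Filter F}
    (f : T -> R) (a p : R) : (0 < p)%R -> (0 <= a)%R -> (forall t, 0 <= f t)%R ->
  f @ F --> a -> (f t `^ p)%R @[t --> F] --> (a `^ p)%R.
Proof.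
move=> p0; rewrite le_eqVlt => /predU1P[<-|a0] f0 fa.
  rewrite powR0 ?gt_eqF//; apply/cvgrPdist_lt => e e0.
  have ep : (0 < e `^ p^-1)%R by rewrite powR_gt0.
  have eE : ((e `^ p^-1) `^ p = e)%R.
    by rewrite -powRrM mulVf ?gt_eqF// powRr1// ltW.
  move/cvgrPdist_lt : fa => /(_ _ ep); apply: filterS => t.
  rewrite !sub0r !normrN !ger0_norm ?powR_ge0// => ft.
  by rewrite -[ltRHS]eE; apply: gt0_ltr_powR => //; rewrite nnegrE// powR_ge0.
have cp : {for a, continuous (@powR R ^~ p)}; last first.
  exact: (@continuous_cvg _ _ _ _ _ _ (@powR R ^~ p) _ cp fa).
apply: differentiable_continuous.
apply/derivable1_diffP; apply: derivable_powR.
by rewrite in_itv/= a0.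
Qed.

Section TruncatedPower.
Context {d} {T : measurableType d} {R : realType}.
Variables (mu : {measure set T -> \bar R}) (p : R) (rho : T -> \bar R).
Hypotheses (mufin : mu setT < +oo) (p1 : (1 <= p)%R).
Hypotheses (mrho : measurable_fun setT rho) (rho0 : forall z, 0 <= rho z).

(** Outside a small exceptional set, this dominates the [p]-th power of the
    Lipschitz weight built from [rho] at height [t = n + 1] with tolerance
    [eta = 1 / t]: that weight is at most [rho + 5 * eta] where [rho <= t], and
    at most [2 * (t + 3 * eta) <= 8 * t] elsewhere. *)
Definition truncated_power (n : nat) (z : T) : \bar R :=
  if rho z <= n.+1%:R%:E then (rho z + (5 / n.+1%:R)%:E) `^ p
  else ((8 * n.+1%:R) `^ p)%:E.

Lemma truncated_power_ge0 n z : 0 <= truncated_power n z.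
Proof.
by rewrite /truncated_power; case: ifP; rewrite ?lee_fin ?powR_ge0 ?poweR_ge0.
Qed.

Lemma measurable_truncated_power n : measurable_fun setT (truncated_power n).
Proof.
apply: measurable_fun_ifT => //; first exact: measurable_fun_lee.
apply: (measurableT_comp (measurable_poweR p)).
exact: emeasurable_funD.
Qed.

Let p0 : (0 < p)%R. Proof. exact: lt_le_trans ltr01 p1. Qed.

(** Where [rho] exceeds [n + 1], the value [8 * (n + 1)] is itself bounded by
    [8 * rho]; hence a domination independent of [n]. *)
Lemma truncated_power_le n z :
  truncated_power n z <= (16 `^ p)%:E * rho z `^ p + (80 `^ p)%:E.
Proof.
have := rho0 z; rewrite /truncated_power; case: (rho z) => [r| |]//; last first.
  by move=> _; rewrite poweRyr ?gt_eqF// gt0_muley ?lte_fin ?powR_gt0// addye// leey.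
rewrite !lee_fin => r0.
have n1 : (1 <= n.+1%:R :> R)%R by rewrite ler1n.
have main b : (0 <= b)%R -> (b <= 8 * (r + 5))%R ->
    (b `^ p <= 16 `^ p * r `^ p + 80 `^ p)%R.
  move=> b0 br; have [r5|r5] := leP r 5%R.
    apply: (@le_trans _ _ (80 `^ p)%R); last by rewrite lerDr mulr_ge0 ?powR_ge0.
    by apply: ge0_ler_powR; rewrite ?nnegrE ?(ltW p0)//; lra.
  rewrite -powRM//; apply: (@le_trans _ _ ((16 * r) `^ p)%R).
    by apply: ge0_ler_powR; rewrite ?nnegrE ?(ltW p0)//; lra.
  by rewrite lerDl powR_ge0.
have [n50 n55] : (0 <= 5 / n.+1%:R :> R)%R /\ (5 / n.+1%:R <= 5 :> R)%R.
  by split; [exact: divr_ge0|rewrite ler_pdivrMr// ler_peMr].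
case: ifPn => [_|].
  move: n50 n55; set q := (5 / _)%R => q0 q5.
  by rewrite -EFinD poweR_EFin lee_fin; apply: main; lra.
by rewrite -ltNge => nr; rewrite lee_fin; apply: main; lra.
Qed.

Lemma truncated_power_pointwise z :
  truncated_power n z @[n --> \oo] --> rho z `^ p.
Proof.
have := rho0 z; rewrite /truncated_power; case: (rho z) => [r| |]//; last first.
  move=> _; rewrite poweRyr ?gt_eqF//; apply/cvgeyPge => A.
  near=> n; rewrite leye_eq/= lee_fin.
  have n1 : (1 <= n.+1%:R :> R)%R by rewrite ler1n.
  apply: (@le_trans _ _ n.+1%:R%R).
    apply: (@le_trans _ _ n%:R%R); last by rewrite ler_nat.
    by near: n; exact: nbhs_infty_ger.
  rewrite -[leLHS]powRr1//; apply: (@le_trans _ _ (n.+1%:R `^ p)%R).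
    exact: ler_powR.
  by apply: ge0_ler_powR; rewrite ?nnegrE ?(ltW p0)//; lra.
rewrite lee_fin => r0; apply: (@cvg_trans _
    ((((r + 5 / n.+1%:R) `^ p)%R)%:E @[n --> \oo])).
  apply: near_eq_cvg; near=> n.
  suff -> : r%:E <= n.+1%:R%:E by rewrite -EFinD poweR_EFin.
  rewrite lee_fin; apply: (@le_trans _ _ n%:R%R); last by rewrite ler_nat.
  by near: n; exact: nbhs_infty_ger.
rewrite poweR_EFin; apply: cvg_EFin; first exact: nearW.
apply: cvg_powR => //; first by move=> n; rewrite addr_ge0// divr_ge0.
rewrite -[X in _ --> X]addr0; apply: cvgD; first exact: cvg_cst.
by rewrite -(mulr0 5%R); apply: cvgMr; exact: cvg_harmonic.
Unshelve. all: by end_near. Qed.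

Lemma integral_truncated_power_cvg : \int[mu]_z (rho z `^ p) < +oo ->
  \int[mu]_z truncated_power n z @[n --> \oo] --> \int[mu]_z (rho z `^ p).
Proof.
move=> rhofin.
have mrp : measurable_fun setT (fun z => rho z `^ p).
  exact: (measurableT_comp (measurable_poweR p)).
have := @dominated_convergence _ _ _ mu setT measurableT truncated_power
  (fun z => rho z `^ p) (fun z => (16 `^ p)%:E * rho z `^ p + (80 `^ p)%:E).
case=> //.
- exact: measurable_truncated_power.
- by apply: aeW => z _; exact: truncated_power_pointwise.
- apply: integrableD => //.
    apply: integrableZl => //; apply/integrableP; split => //.
    by under eq_integral do rewrite gee0_abs ?poweR_ge0//.
  apply/integrableP; split => //.
  under eq_integral do rewrite gee0_abs ?lee_fin ?powR_ge0//.
  by rewrite integral_cst// lte_mul_pinfty ?lee_fin ?powR_ge0.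
- apply: aeW => z n _; rewrite gee0_abs ?truncated_power_ge0//.
  exact: truncated_power_le.
Qed.

End TruncatedPower.

(** * Approximation of weights by Lipschitz weights *)

Section BorelFunctions.
Context {R : realType} {X : pmetricType R}.
Local Notation borelType := (g_sigma_algebraType (@open X)).

Lemma lsc_borel_fun (f : X -> \bar R) :
  (forall a : R, open [set z | a%:E < f z]) -> borel_fun f.
Proof.
move=> lf; apply: (measurability _ (ErealGenOInfty.measurableE R)).
move=> /= _ [_ [a ->]] <-; rewrite setTI; apply: sub_sigma_algebra.
by rewrite preimage_itvoy; exact: lf.
Qed.

Lemma lsc_borel_rfun (f : X -> R) :
  (forall a : R, open [set z | (a < f z)%R]) -> borel_rfun f.
Proof.
move=> lf; apply/measurable_EFinP; apply: lsc_borel_fun => a.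
by have := lf a; congr open; apply/seteqP; split => z /=; rewrite lte_fin.
Qed.

Lemma locally_lipschitz_borel (f : X -> R) :
  (forall z, exists (K e : R), (0 < e)%R /\ forall w, (mdist z w < e)%R ->
     (`|f z - f w| <= K * mdist z w)%R) -> borel_rfun f.
Proof.
move=> lf; apply: lsc_borel_rfun => a; rewrite openE => z /= az.
have [K [e [e0 Kf]]] := lf z; apply/nbhs_ballP.
pose r := ((f z - a) / (`|K| + 1))%R.
have K1 : (0 < `|K| + 1)%R by rewrite ltr_wpDl.
exists (Num.min e r); first by rewrite /= lt_min e0 divr_gt0// subr_gt0.
move=> w; rewrite ballEmdist/= lt_min => /andP[we wr].
have := Kf w we; rewrite ler_norml => /andP[_].
rewrite ltr_pdivlMr// mulrDr mulr1 in wr.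
have : (K * mdist z w <= mdist z w * `|K|)%R.
  by rewrite mulrC ler_wpM2l ?mdist_ge0// ler_norm.
by have := mdist_ge0 z w; lra.
Qed.

Lemma Lipschitz_borel (f : X -> R) : Lipschitz f -> borel_rfun f.
Proof.
move=> [K Kf]; apply: locally_lipschitz_borel => z; exists K, 1%R.
by split => // w _; exact: Kf.
Qed.

End BorelFunctions.

Section LipschitzDensity.
Context {R : realType} {X : pmetricType R}.
Local Notation borelType := (g_sigma_algebraType (@open X)).
Variables (mu : {measure set borelType -> \bar R}) (p : R).
Hypotheses (mufin : mu setT < +oo) (p1 : (1 <= p)%R).

(** Lipschitz weights are dense in energy among the admissible ones, at the
    price of a smaller scale [e']. The potential [u] of [rho] satisfies
    [|u z - u w| <= (rho z + rho w) / 2 * mdist z w] at scale [e], so it is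
    Lipschitz with constant [t] on a sublevel set [rho <= t] as soon as
    [1 / e <= t]. Its restriction to a set [K] given by [lusin_levels] extends
    with slope bounded by a Lipschitz weight [h] that is close to [rho] on [K]
    and at most [8 * t] outside. The cost of the complement of [K] is
    controlled by [truncated_power] where [rho > t], and by the choice of [K],
    made after that of [t], where [rho <= t]. *)
Lemma lipschitz_admissible_approx (x y : X) (rho : X -> \bar R) (e theta : R) :
  (0 < e)%R -> (0 < theta)%R -> borel_fun rho -> (forall z, 0 <= rho z) ->
  rho x < +oo -> rho y < +oo ->
  (forall c, (chains_from_to x y `&` eps_chains e) c -> 1 <= chain_integral rho c) ->
  \int[mu]_z (rho z `^ p) < +oo ->
  exists (v h : X -> R) (e' : R),
    [/\ Lipschitz v, Lipschitz h, (0 < e')%R, v x = 0%R & v y = 1%R] /\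
    [/\ forall z, (0 <= h z)%R,
        forall z w, (mdist z w <= e')%R -> (`|v z - v w| <= h z * mdist z w)%R &
        \int[mu]_z (h z `^ p)%:E <= \int[mu]_z (rho z `^ p) + theta%:E].
Proof.
move=> e0 theta0 mrho rho0 rhox rhoy adm rhofin.
have p0 : (0 < p)%R by exact: lt_le_trans ltr01 p1.
have [u [u01 ux uy ustep]] := chain_potential e x y rho e0 rho0 adm.
have th2 : (0 < theta / 2)%R by rewrite divr_gt0.
have xfin : rho x \is a fin_num by rewrite ge0_fin_numE.
have yfin : rho y \is a fin_num by rewrite ge0_fin_numE.
have ifin : \int[mu]_z (rho z `^ p) \is a fin_num.
  by rewrite ge0_fin_numE// integral_ge0// => z _; exact: poweR_ge0.
have [n [ne nx ny nint]] : exists n : nat,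
    [/\ (e^-1 <= n.+1%:R)%R, rho x <= n.+1%:R%:E, rho y <= n.+1%:R%:E &
     \int[mu]_z truncated_power (T := borelType) p rho n z <
       \int[mu]_z (rho z `^ p) + (theta / 2)%:E].
  have large (a : R) : \forall n \near \oo, (a <= n.+1%:R)%R.
    near=> k; apply: (@le_trans _ _ k%:R%R); last by rewrite ler_nat.
    by near: k; exact: nbhs_infty_ger.
  near \oo => n; exists n.
  split.
  - by near: n; exact: large.
  - by rewrite -(fineK xfin) lee_fin; near: n; exact: large.
  - by rewrite -(fineK yfin) lee_fin; near: n; exact: large.
  - near: n.
    have := integral_truncated_power_cvg mu p (rho : borelType -> \bar R)
      mufin p1 mrho rho0 rhofin.
    move=> /(_ [set a | a < \int[mu]_z (rho z `^ p) + (theta / 2)%:E]); apply.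
    apply: open_nbhs_nbhs; split; first exact: open_ereal_lt_ereal.
    by rewrite /= lteDl// lte_fin.
set t : R := n.+1%:R%R in ne nx ny.
have t1 : (1 <= t)%R by rewrite ler1n.
pose eta : R := (t^-1)%R.
have eta0 : (0 < eta)%R by rewrite invr_gt0; lra.
have eta1 : (eta <= 1)%R by rewrite invf_le1//; lra.
have T0 : (0 < (8 * t) `^ p)%R by rewrite powR_gt0//; lra.
pose e1 := Num.min 1%R ((theta / 2) / (8 * t) `^ p)%R.
have e10 : (0 < e1)%R by rewrite lt_min ltr01 divr_gt0.
(* charging x and y forces the good set to contain them *)
pose dx : {measure set borelType -> \bar R} := @dirac _ borelType x R.
pose dy : {measure set borelType -> \bar R} := @dirac _ borelType y R.
pose nu := measure_add mu (measure_add dx dy).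
have nuE A : nu A = mu A + (dx A + dy A).
  by rewrite /nu measure_addE; congr (_ + _); exact: measure_addE.
have dxE (A : set borelType) : dx A = (\1_A (x : borelType))%:E by [].
have dyE (A : set borelType) : dy A = (\1_A (y : borelType))%:E by [].
have nufin : nu setT < +oo.
  by rewrite nuE lte_add_pinfty// dxE dyE -EFinD ltry.
have [K [r [mK nuK r0 Kt Keta]]] :=
  lusin_levels nu nufin rho t eta e1 mrho rho0 eta0 e10.
set B : set borelType := [set z | rho z <= t%:E] `\` K in nuK.
have mB : measurable B.
  apply: measurableD => //; rewrite -[X in measurable X]setTI.
  exact: emeasurable_fun_infty_c.
have [muB dxB dyB] : [/\ mu B < e1%:E, dx B < 1 & dy B < 1].
  have e11 : e1%:E <= 1 by rewrite lee_fin ge_min lexx.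
  have {}nuK : mu B + (dx B + dy B) < e1%:E by rewrite -nuE.
  split.
  - by apply: le_lt_trans nuK; rewrite leeDl// adde_ge0.
  - apply: lt_le_trans e11; apply: le_lt_trans nuK.
    by rewrite addeCA leeDl// adde_ge0.
  - apply: lt_le_trans e11; apply: le_lt_trans nuK.
    by rewrite addeA leeDr// adde_ge0.
have Kx : K x.
  apply: contrapT => nKx; move: dxB.
  by rewrite dxE indicE mem_set//= ltxx.
have Ky : K y.
  apply: contrapT => nKy; move: dyB.
  by rewrite dyE indicE mem_set//= ltxx.
have Kfin z : K z -> rho z \is a fin_num.
  by move=> /Kt zt; rewrite ge0_fin_numE// (le_lt_trans zt)// ltry.
pose a z := fine (rho z).
have a0t z : K z -> (0 <= a z <= t)%R.
  move=> Kz; rewrite /a fine_ge0//=; have := Kt z Kz.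
  by rewrite -(fineK (Kfin z Kz)) lee_fin.
have astep z w : K z -> K w -> (mdist z w <= e)%R ->
    (`|u z - u w| <= (a z + a w) / 2 * mdist z w)%R.
  move=> Kz Kw /ustep; rewrite /trapezoid -(fineK (Kfin z Kz)) -(fineK (Kfin w Kw)).
  by rewrite -EFinD -!EFinM lee_fin.
have := @lipschitz_extension_slope R X K u a t eta (Num.min r e).
case=> //.
- by exists x.
- by rewrite lt_min r0.
- by move=> z Kz; have /andP[] := u01 z.
- move=> z w Kz Kw; have [zwe|ezw] := leP (mdist z w) e.
    apply: le_trans (astep z w Kz Kw zwe) _; rewrite ler_wpM2r ?mdist_ge0//.
    by have := a0t z Kz; have := a0t w Kw; lra.
  apply: (@le_trans _ _ 1%R).
    by rewrite ler_norml; have := u01 z; have := u01 w; lra.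
  have : (e^-1 * e <= t * mdist z w)%R.
    by rewrite ler_pM ?invr_ge0 ?(ltW e0)// ltW.
  by rewrite mulVf// gt_eqF.
- move=> z w Kz Kw; rewrite lt_min => /andP[zwr zwe].
  have azw := Keta z w Kz Kw zwr; split => //.
  apply: le_trans (astep z w Kz Kw (ltW zwe)) _; rewrite ler_wpM2r ?mdist_ge0//.
  by move: azw; rewrite -/(a z) -/(a w); lra.
move=> v [h [e' [vL hL e'0 [vu hb hK slope]]]].
have h0 z : (0 <= h z)%R by have /andP[] := hb z.
exists v, h, e'; split; first by rewrite !vu.
split => //.
have mrp : measurable_fun setT (truncated_power (T := borelType) p rho n).
  exact: measurable_truncated_power.
apply: (@le_trans _ _ (\int[mu]_z (truncated_power (T := borelType) p rho n z +
    ((8 * t) `^ p)%:E * (\1_B z)%:E))).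
  apply: ge0_le_integral => //.
  - by move=> z _; rewrite lee_fin powR_ge0.
  - apply/measurable_EFinP.
    by apply: (measurableT_comp (measurable_powR p)); exact: Lipschitz_borel.
  - by apply: emeasurable_funD => //; apply: measurable_funeM;
      apply/measurable_EFinP; exact: measurable_indic.
  - move=> z _; have [Kz|nKz] := pselect (K z).
      apply: (@le_trans _ _ (truncated_power (T := borelType) p rho n z)).
        rewrite /truncated_power (Kt z Kz) -(fineK (Kfin z Kz)) -EFinD poweR_EFin.
        rewrite lee_fin; apply: ge0_ler_powR; rewrite ?nnegrE ?(ltW p0)//.
          by rewrite addr_ge0 ?divr_ge0// fine_ge0.
        exact: hK.
      by rewrite leeDl// mule_ge0 ?lee_fin ?powR_ge0.
    have h8 : (h z `^ p <= (8 * t) `^ p)%R.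
      apply: ge0_ler_powR; rewrite ?nnegrE ?(ltW p0)//; first by lra.
      by have /andP[_ hz] := hb z; apply: le_trans hz _; lra.
    have [zt|zt] := leP (rho z) t%:E.
      rewrite indicE mem_set//= mule1; apply: (@le_trans _ _ ((8 * t) `^ p)%:E) => //.
      by rewrite leeDr// truncated_power_ge0.
    rewrite /truncated_power ifF; last by apply/negbTE; rewrite -ltNge.
    rewrite -EFinM -EFinD lee_fin (le_trans h8)//.
    by rewrite lerDl mulr_ge0// powR_ge0.
rewrite ge0_integralD//; first last.
- apply: measurable_funeM; apply/measurable_EFinP; exact: measurable_indic.
- by move=> z _; rewrite mule_ge0 ?lee_fin ?powR_ge0.
- by move=> z _; rewrite truncated_power_ge0.
rewrite ge0_integralZl//; first last.
- by rewrite lee_fin powR_ge0.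
- apply/measurable_EFinP; exact: measurable_indic.
rewrite integral_indic// setIT [theta]splitr EFinD addeA leeD ?(ltW nint)//.
apply: (@le_trans _ _ (((8 * t) `^ p)%:E * e1%:E)).
  by rewrite lee_wpmul2l ?lee_fin ?powR_ge0// ltW.
rewrite -EFinM lee_fin mulrC -ler_pdivlMr//.
by rewrite ge_min lexx orbT.
Unshelve. all: by end_near. Qed.
End LipschitzDensity.

(** * Measures from set functions and densities *)

(** Integrals against [m] only see its values, so it suffices to exhibit a
    measure on the Borel sets with the same underlying function. *)
Lemma measure_of_caratheodory {R : realType} {X : pmetricType R}
    (m : {outer_measure set X -> \bar R}%R) :
  (forall A, borel_set A -> m.-caratheodory A) ->
  exists M : {measure set (g_sigma_algebraType (@open X)) -> \bar R},
    (M : set X -> \bar R) = m.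
Proof.
move=> cara; pose T := g_sigma_algebraType (@open X).
pose m' : set T -> \bar R := m.
have m0 : m' set0 = 0 by exact: outer_measure0.
have mge0 A : 0 <= m' A by exact: outer_measure_ge0.
have madd : semi_sigma_additive m'.
  move=> F mF tF mUF.
  have mF' i : m.-caratheodory (F i) by exact: cara (mF i).
  exact: (@caratheodory_measure_sigma_additive _ _ m F mF' tF (cara _ mUF)).
pose M : {measure set T -> \bar R} :=
  HB.pack m' (isMeasure.Build _ T R m' m0 mge0 madd).
by exists M.
Qed.

Lemma measure_with_density d (T : measurableType d) (R : realType)
    (M : {measure set T -> \bar R}) (f : T -> \bar R) :
  measurable_fun setT f -> (forall z, 0 <= f z) ->
  exists N : {measure set T -> \bar R},
    (N : set T -> \bar R) = (fun A => \int[M]_(z in A) f z).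
Proof.
move=> mf f0; pose N : set T -> \bar R := fun A => \int[M]_(z in A) f z.
have N0 : N set0 = 0 by exact: integral_set0.
have Nge0 A : 0 <= N A by apply: integral_ge0.
have Nadd : semi_sigma_additive N.
  move=> F mF tF mUF; rewrite /N ge0_integral_bigcup//.
    by apply: is_cvg_ereal_nneg_natsum_cond => n _ _; exact: integral_ge0.
  by apply: measurable_funTS.
pose N' : {measure set T -> \bar R} :=
  HB.pack N (isMeasure.Build _ T R N N0 Nge0 Nadd).
by exists N'.
Qed.

(** * The Riesz kernel *)

Section RieszMeasure.
Context {R : realType} {X : pmetricType R}.
Local Notation borelType := (g_sigma_algebraType (@open X)).
Variable M : {measure set borelType -> \bar R}.
Hypothesis Mnontriv : M setT != 0.
Hypothesis Mfin : forall (x : X) r, M (ball x r) < +oo.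
Variable CD : R.
Hypothesis CD1 : (1 <= CD)%R.
Hypothesis Mdbl : forall (x : X) r, (0 < r)%R ->
  M (ball x (2 * r)%R) <= CD%:E * M (ball x r).

Lemma measurable_ball (x : X) r : measurable (ball x r : set borelType).
Proof.
apply: sub_sigma_algebra; rewrite openE => z; rewrite ballEmdist/= => xz.
apply/nbhs_ballP; exists (r - mdist x z)%R; first by rewrite /= subr_gt0.
move=> w; rewrite !ballEmdist/=; have := metric_triangle x z w; lra.
Qed.

Lemma doubling_ball_gt0 (x : X) r : (0 < r)%R -> 0 < M (ball x r).
Proof.
move=> r0; rewrite lt0e measure_ge0 andbT; apply: contra Mnontriv => /eqP Mr.
have M0 n : M (ball x (2 ^+ n * r)%R) = 0.
  elim: n => [|n IH]; first by rewrite expr0 mul1r.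
  apply/eqP; rewrite eq_le measure_ge0 andbT exprS -mulrA.
  have := Mdbl x (2 ^+ n * r)%R; rewrite IH mule0; apply.
  by rewrite mulr_gt0// exprn_gt0.
rewrite eq_le measure_ge0 andbT.
apply: (@le_trans _ _ (\sum_(0 <= n <oo) M (ball x (2 ^+ n * r)%R))).
  apply: measure_sigma_subadditive => //.
    by move=> n; exact: measurable_ball.
  move=> z _; pose n := (Num.truncn (mdist x z / r)).+1; exists n => //.
  rewrite ballEmdist/= -ltr_pdivrMr//.
  apply: (@lt_trans _ _ n%:R%R).
    by have /andP[] := truncn_itv (divr_ge0 (mdist_ge0 x z) (ltW r0)).
  by rewrite -natrX ltr_nat ltn_expl.
by rewrite eseries0// => i _ _; rewrite M0.
Qed.

Lemma ball_fin_num (x : X) r : M (ball x r) \is a fin_num.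
Proof. by rewrite ge0_fin_numE. Qed.

Definition ball_vol (x : X) (r : R) : R := fine (M (ball x r)).

Lemma ball_volE x r : M (ball x r) = (ball_vol x r)%:E.
Proof. by rewrite /ball_vol fineK// ball_fin_num. Qed.

Lemma ball_vol_ge0 x r : (0 <= ball_vol x r)%R.
Proof. by rewrite /ball_vol fine_ge0. Qed.

Lemma ball_vol_gt0 x r : (0 < r)%R -> (0 < ball_vol x r)%R.
Proof. by move=> r0; rewrite fine_gt0// doubling_ball_gt0//=. Qed.

Lemma ball_vol_nondecreasing x : {homo ball_vol x : r s / (r <= s)%R}.
Proof.
move=> r s rs; rewrite /ball_vol fine_le ?ball_fin_num//; apply: le_measure.
- by rewrite inE; exact: measurable_ball.
- by rewrite inE; exact: measurable_ball.
- exact: le_ball.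
Qed.

(** At [z = x] this is [0 / 0], that is [0 * +oo = 0], which agrees with the
    normalization of the Riesz kernel at its poles. *)
Definition riesz_pole (x z : X) : \bar R :=
  (mdist x z)%:E / M (ball x (mdist x z)).

Lemma riesz_poleE x z :
  riesz_pole x z = (mdist x z * (ball_vol x (mdist x z))^-1)%:E.
Proof.
rewrite /riesz_pole ball_volE inver; have [->|xz] := eqVneq x z.
  by rewrite mdistxx mul0r; case: ifPn; rewrite mul0e.
by rewrite gt_eqF// ball_vol_gt0// mdist_gt0.
Qed.

Lemma riesz_pole_ge0 x z : 0 <= riesz_pole x z.
Proof.
by rewrite riesz_poleE lee_fin mulr_ge0 ?mdist_ge0// invr_ge0 ball_vol_ge0.
Qed.

(** It is a function of the distance to [x] alone, built from the monotone
    function [ball_vol x]. *)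
Lemma measurable_riesz_pole x : borel_fun (riesz_pole x).
Proof.
rewrite /borel_fun (_ : riesz_pole x = (EFin \o
    ((fun r => r * (ball_vol x r) `^ (-1)) \o mdist x))%R); last first.
  by apply/funext => z; rewrite riesz_poleE/= powR_inv1// ball_vol_ge0.
apply/measurable_EFinP; apply: measurableT_comp.
  apply: measurable_funM => //.
  apply: (measurableT_comp (measurable_powR (-1))).
  exact: nondecreasing_measurable (ball_vol_nondecreasing x).
apply: Lipschitz_borel; exists 1%R => z w; rewrite mul1r ler_norml.
have := metric_triangle x z w; have := metric_triangle x w z.
by rewrite (metric_sym w z); lra.
Qed.

Lemma measurable_riesz_pole_restrict x r :
  borel_fun (riesz_pole x \_ (ball x r)).
Proof.
apply/(measurable_restrictT _ (measurable_ball x r)).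
by apply: measurable_funTS; exact: measurable_riesz_pole.
Qed.

(** On the annulus between the radii [s] and [2 * s] the pole is at most
    [2 * s] divided by the mass of the ball of radius [s], and by doubling the
    mass of the annulus is at most [CD] times that mass. *)
Lemma riesz_pole_annulus x r k : (0 < r)%R ->
  \int[M]_(z in ball x (r / (2 ^ k)%:R) `\` ball x (r / (2 ^ k.+1)%:R))
    riesz_pole x z <= (2 * CD * r / (2 ^ k.+1)%:R)%:E.
Proof.
move=> r0; set A := _ `\` _.
set s := (r / (2 ^ k.+1)%:R)%R.
have s0 : (0 < s)%R by rewrite divr_gt0// ltr0n expn_gt0.
have sE : (r / (2 ^ k)%:R = 2 * s)%R.
  by rewrite /s expnS natrM; field; rewrite pnatr_eq0 -lt0n expn_gt0.
have mA : measurable (A : set borelType).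
  by apply: measurableD; exact: measurable_ball.
have V0 := ball_vol_gt0 x s s0.
apply: (@le_trans _ _ (\int[M]_(z in A) (2 * s * (ball_vol x s)^-1)%:E)).
  apply: ge0_le_integral => //.
  - by move=> z _; exact: riesz_pole_ge0.
  - by apply: measurable_funTS; exact: measurable_riesz_pole.
  - move=> z []; rewrite sE !ballEmdist/= => xz /negP; rewrite -leNgt => sz.
    rewrite riesz_poleE lee_fin; apply: ler_pM; rewrite ?mdist_ge0//.
    + by rewrite invr_ge0 ball_vol_ge0.
    + exact: ltW.
    + rewrite lef_pV2 ?posrE//; first exact: ball_vol_nondecreasing.
      by apply: ball_vol_gt0; apply: lt_le_trans sz.
rewrite integral_cst//; apply: (@le_trans _ _ ((2 * s * (ball_vol x s)^-1)%:E *
    (CD%:E * (ball_vol x s)%:E))).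
  apply: lee_wpmul2l.
    by rewrite lee_fin !mulr_ge0 ?invr_ge0// ltW.
  rewrite -ball_volE; apply: le_trans (Mdbl x s s0); rewrite -sE.
  by apply: le_measure; rewrite ?inE//; [exact: measurable_ball|move=> z []].
rewrite -!EFinM lee_fin -sE -/s.
rewrite le_eqVlt; apply/orP; left; apply/eqP.
rewrite sE -[in RHS]mulrA -/s; field; exact: lt0r_neq0.
Qed.

(** The dyadic annuli exhaust the ball except for its center, where the pole
    vanishes; their contributions form a geometric series. *)
Lemma integral_riesz_pole_lty x r : \int[M]_(z in ball x r) riesz_pole x z < +oo.
Proof.
have [r0|r0] := leP r 0%R.
  rewrite (_ : ball x r = set0) ?integral_set0//.
  rewrite -subset0 => z; rewrite ballEmdist/= => zr.
  by have := mdist_ge0 x z; lra.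
pose A k : set borelType := ball x (r / (2 ^ k)%:R) `\` ball x (r / (2 ^ k.+1)%:R).
have mA k : measurable (A k) by apply: measurableD; exact: measurable_ball.
have half_le j k : (j <= k)%N -> (r / (2 ^ k)%:R <= r / (2 ^ j)%:R)%R.
  move=> jk; rewrite ler_pM2l// lef_pV2 ?posrE ?ltr0n ?expn_gt0//.
  by rewrite ler_nat leq_exp2l.
have -> : \int[M]_(z in ball x r) riesz_pole x z =
    \int[M]_(z in \bigcup_k A k) riesz_pole x z.
  rewrite integral_mkcond [RHS]integral_mkcond; apply: eq_integral => z _.
  rewrite !patchE; have [<-|xz] := eqVneq x z.
    by rewrite riesz_poleE mdistxx mul0r !if_same.
  suff -> : (z \in (ball x r : set borelType)) = (z \in \bigcup_k A k) by [].
  apply/idP/idP; rewrite !inE.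
    rewrite ballEmdist/= => xzr.
    have d0 : (0 < mdist x z)%R by rewrite mdist_gt0.
    have ex : exists n, (r / (2 ^ n)%:R <= mdist x z)%R.
      exists (Num.truncn (r / mdist x z)).+1.
      rewrite ler_pdivrMr ?ltr0n ?expn_gt0// mulrC -ler_pdivrMr//.
      apply: (@le_trans _ _ (Num.truncn (r / mdist x z)).+1%:R%R).
        by have /andP[_ /ltW] := truncn_itv (divr_ge0 (ltW r0) (ltW d0)).
      by rewrite ler_nat ltnW// ltn_expl.
    (* the first dyadic radius not exceeding the distance of z is the inner radius
       of its annulus *)
    case: (ex_minnP ex) => -[|n] nd nmin.
      by move: nd; rewrite expn0 divr1 leNgt xzr.
    exists n => //; split; rewrite ballEmdist/=; last by apply/negP; rewrite -leNgt.
    by rewrite ltNge; apply/negP => /nmin; rewrite ltnn.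
  move=> [k _ []]; rewrite !ballEmdist/= => xzk _; apply: lt_le_trans xzk _.
  by have := half_le 0%N k isT; rewrite expn0 divr1.
rewrite ge0_integral_bigcup//; first last.
- apply/trivIsetP => i j _ _.
  wlog ij : i j / (i < j)%N.
    move=> wl; rewrite neq_ltn => /orP[ij|ji].
      by apply: wl => //; rewrite lt_eqF.
    by rewrite setIC; apply: wl => //; rewrite lt_eqF.
  move=> _; rewrite -subset0 => z [[_ nz] [zj _]]; apply: nz.
  by apply: le_ball zj; exact: half_le.
- by move=> z _; exact: riesz_pole_ge0.
- by apply: measurable_funTS; exact: measurable_riesz_pole.
apply: (@le_lt_trans _ _ (2 * CD * r)%:E); last exact: ltry.
apply: le_trans (epsilon_trick0 xpredT _); last first.
  by rewrite !mulr_ge0 ?(ltW r0)//; exact: le_trans ler01 CD1.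
apply: lee_nneseries => [i _ _|i _].
  by apply: integral_ge0 => z _; exact: riesz_pole_ge0.
exact: riesz_pole_annulus.
Qed.

Variables (L : R) (x y : X).

Lemma riesz_kernel_ge0 z : 0 <= riesz_kernel (M : set X -> \bar R) L x y z.
Proof.
rewrite /riesz_kernel; case: ifP => // _.
by rewrite mule_ge0// adde_ge0//; exact: riesz_pole_ge0.
Qed.

Lemma measurable_riesz_kernel :
  borel_fun (riesz_kernel (M : set X -> \bar R) L x y).
Proof.
have m1 (w : X) : measurable_fun (setT : set borelType) (fun z : borelType => z == w).
  apply: (measurable_fun_bool true); rewrite setTI.
  have -> : (fun z : borelType => z == w) @^-1` [set true] = [set w].
    by apply/seteqP; split => z /= /eqP.
  rewrite -[[set w]]setCK; apply: measurableC; apply: sub_sigma_algebra.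
  apply: closed_openC; apply: accessible_closed_set1.
  exact: hausdorff_accessible (@metric_hausdorff R X).
apply: measurable_fun_ifT => //.
  exact: measurable_or.
apply: emeasurable_funM.
  apply: emeasurable_funD; exact: measurable_riesz_pole.
apply/measurable_EFinP; apply: measurable_indic.
by apply: measurableU; exact: measurable_ball.
Qed.

Lemma integral_riesz_kernel_lty :
  \int[M]_z (riesz_kernel (M : set X -> \bar R) L x y z) < +oo.
Proof.
set r := ((`|L| + 1) * mdist x y)%R.
have rx z : (ball x (L * mdist x y)%R `|` ball y (L * mdist x y)%R) z ->
    ball x r z /\ ball y r z.
  have := metric_triangle x y z; have := metric_triangle y x z.
  rewrite (metric_sym y x) /r !ballEmdist/= mulrDl mul1r.
  have : (L * mdist x y <= `|L| * mdist x y)%R.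
    by rewrite ler_wpM2r ?mdist_ge0// ler_norm.
  have := mdist_ge0 x y.
  by move=> ? ? ? ? []; lra.
apply: (@le_lt_trans _ _ (\int[M]_z (((riesz_pole x) \_ (ball x r)) z +
    ((riesz_pole y) \_ (ball y r)) z))).
  apply: ge0_le_integral => //.
  - by move=> z _; exact: riesz_kernel_ge0.
  - exact: measurable_riesz_kernel.
  - by apply: emeasurable_funD; exact: measurable_riesz_pole_restrict.
  - move=> z _; rewrite /riesz_kernel; case: ifP => _.
      by rewrite adde_ge0// erestrict_ge0// => w _; exact: riesz_pole_ge0.
    rewrite indicE; have [/set_mem/rx[zx zy]|_] := boolP (z \in _).
      by rewrite mule1 !patchE !mem_set.
    by rewrite mule0 adde_ge0// erestrict_ge0// => w _; exact: riesz_pole_ge0.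
rewrite ge0_integralD//.
- rewrite lte_add_pinfty// -integral_mkcond; exact: integral_riesz_pole_lty.
- by move=> z _; rewrite erestrict_ge0// => w _; exact: riesz_pole_ge0.
- exact: measurable_riesz_pole_restrict.
- by move=> z _; rewrite erestrict_ge0// => w _; exact: riesz_pole_ge0.
- exact: measurable_riesz_pole_restrict.
Qed.

End RieszMeasure.

(** * Slopes at a fixed scale and the local Lipschitz constant *)

Section MonotoneLimits.
Context {R : realType} (f : R -> \bar R).

Lemma lim_at_right0_inf : (forall a b, (0 < a)%R -> (a <= b)%R -> f a <= f b) ->
  lim (f @ 0^'+) = ereal_inf [set f e | e in [set e : R | (0 < e)%R]].
Proof.
move=> nf; have := @nondecreasing_at_right_cvge R f 0%R (BInfty R false).
rewrite (_ : [set` Interval (BRight 0%R) (BInfty R false)] = [set e : R | (0 < e)%R]).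
  move=> H; apply/cvg_lim => //; apply: H => // a b.
  by rewrite !in_itv/= !andbT => a0 _; exact: nf.
by apply/seteqP; split => z /=; rewrite in_itv/= andbT.
Qed.

Lemma lim_at_right0_sup : (forall a b, (0 < a)%R -> (a <= b)%R -> f b <= f a) ->
  lim (f @ 0^'+) = ereal_sup [set f e | e in [set e : R | (0 < e)%R]].
Proof.
move=> nf; have := @nonincreasing_at_right_cvge R f 0%R (BInfty R false).
rewrite (_ : [set` Interval (BRight 0%R) (BInfty R false)] = [set e : R | (0 < e)%R]).
  move=> H; apply/cvg_lim => //; apply: H => // a b.
  by rewrite !in_itv/= !andbT => a0 _; exact: nf.
by apply/seteqP; split => z /=; rewrite in_itv/= andbT.
Qed.

Lemma cvg_harmonic_inf : (forall a b, (0 < a)%R -> (a <= b)%R -> f a <= f b) ->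
  f (n.+1%:R^-1)%R @[n --> \oo] -->
    ereal_inf [set f e | e in [set e : R | (0 < e)%R]].
Proof.
move=> nf.
rewrite (_ : ereal_inf _ = ereal_inf (range (fun n : nat => f (n.+1%:R^-1)%R))).
  apply: ereal_nonincreasing_cvgn => m n mn.
  by apply: nf; rewrite ?invr_gt0// lef_pV2 ?posrE// ler_nat.
apply/eqP; rewrite eq_le; apply/andP; split; apply: le_ereal_inf_tmp.
  move=> _ [n _ <-]; apply: ereal_inf_lbound.
  by exists (n.+1%:R^-1)%R; rewrite //= invr_gt0.
move=> _ [e /= e0 <-].
have [n _ /(_ n (leqnn n))/= ne] := near_infty_natSinv_lt (PosNum e0).
apply: (@le_trans _ _ (f (n.+1%:R^-1)%R)).
  by apply: ereal_inf_lbound; exists n.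
by apply: nf; rewrite ?invr_gt0// ltW.
Qed.

End MonotoneLimits.

Section Slope.
Context {R : realType} {X : pmetricType R}.
Local Notation borelType := (g_sigma_algebraType (@open X)).
Implicit Types (u : X -> R) (z w : X) (e : R).

Definition difference_quotients u z e : set (\bar R) :=
  [set (`|u w - u z| / mdist z w)%:E | w in [set w | ball z e w /\ w <> z]].

(** The maximum with [0] makes isolated points, where the supremum of the empty
    set is [-oo], fit the general case. *)
Definition slope e u z : \bar R := maxe 0 (ereal_sup (difference_quotients u z e)).

Lemma slope_ge0 e u z : 0 <= slope e u z.
Proof. by rewrite le_max lexx. Qed.

Lemma difference_quotients_le u z a b : (a <= b)%R ->
  ereal_sup (difference_quotients u z a) <= ereal_sup (difference_quotients u z b).
Proof.
move=> ab; apply: ereal_sup_le => _ [w [zw wz] <-].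
by exists w => //; split => //; exact: le_ball zw.
Qed.

Lemma slope_le_radius u z a b : (a <= b)%R -> slope a u z <= slope b u z.
Proof.
by move=> ab; rewrite ge_max !le_max lexx/= difference_quotients_le// orbT.
Qed.

Lemma slope_le (k : R) e u z : (0 <= k)%R ->
  (forall w, (mdist z w < e)%R -> (`|u z - u w| <= k * mdist z w)%R) ->
  slope e u z <= k%:E.
Proof.
move=> k0 ku; rewrite ge_max lee_fin k0/=; apply: ge_ereal_sup => _ [w [zw wz] <-].
rewrite lee_fin ler_pdivrMr; last by rewrite mdist_gt0 eq_sym; exact/eqP.
by rewrite distrC; apply: ku; rewrite ballEmdist in zw.
Qed.

Lemma slope_ge e u z w : (mdist z w < e)%R ->
  `|u z - u w|%:E <= slope e u z * (mdist z w)%:E.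
Proof.
move=> zw; have [->|zNw] := eqVneq z w; first by rewrite subrr normr0 mdistxx mule0.
have d0 : (0 < mdist z w)%R by rewrite mdist_gt0.
apply: (@le_trans _ _ ((`|u w - u z| / mdist z w)%:E * (mdist z w)%:E)).
  by rewrite -EFinM lee_fin distrC divfK// gt_eqF.
rewrite lee_wpmul2r ?lee_fin ?(ltW d0)// le_max; apply/orP; right.
apply: ereal_sup_ubound; exists w => //; split; first by rewrite ballEmdist.
by move=> wz; rewrite wz eqxx in zNw.
Qed.

(** At an isolated point the slope vanishes at small scales; elsewhere the
    difference quotients are nonnegative and their supremum is monotone in the
    radius. *)
Lemma lip_inf_slope u z :
  lip u z = ereal_inf [set slope e u z | e in [set e : R | (0 < e)%R]].
Proof.
rewrite /lip; case: ifPn => [/asboolP[_ [V /nbhs_ballP[r r0 rV] VE]]|].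
  apply/eqP; rewrite eq_le; apply/andP; split.
    by apply: le_ereal_inf_tmp => _ [e _ <-]; exact: slope_ge0.
  apply: ereal_inf_lbound; exists r => //; apply/max_idPl.
  apply: ge_ereal_sup => _ [w [zw wz] <-].
  have : (V `&` setT) w by split => //; exact: rV.
  by rewrite VE => /wz.
move/asboolPn => niso.
have dq0 e : (0 < e)%R -> 0 <= ereal_sup (difference_quotients u z e).
  move=> e0; have [w [zw wz]] : exists w, ball z e w /\ w <> z.
    apply: contrapT => nw; apply: niso; split; first exact: in_setT.
    exists (ball z e); first exact: nbhsx_ballx.
    apply/seteqP; split => [w [zw _]|_ ->]; last first.
      by split => //; exact: ballxx.
    by apply: contrapT => wz; apply: nw; exists w.
  apply: (@le_trans _ _ (`|u w - u z| / mdist z w)%:E).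
    by rewrite lee_fin divr_ge0// mdist_ge0.
  by apply: ereal_sup_ubound; exists w.
rewrite lim_at_right0_inf; last by move=> a b _; exact: difference_quotients_le.
by congr ereal_inf; apply: eq_imagel => e /= e0; rewrite /slope (max_idPr (dq0 e e0)).
Qed.

Lemma lip_le_slope e u z : (0 < e)%R -> lip u z <= slope e u z.
Proof. by move=> e0; rewrite lip_inf_slope; apply: ereal_inf_lbound; exists e. Qed.

Lemma lip_ge0 u z : 0 <= lip u z.
Proof.
by rewrite lip_inf_slope; apply: le_ereal_inf_tmp => _ [e _ <-]; exact: slope_ge0.
Qed.

Lemma slope_cvg_lip u z : slope (n.+1%:R^-1)%R u z @[n --> \oo] --> lip u z.
Proof.
rewrite lip_inf_slope; apply: (cvg_harmonic_inf (fun e => slope e u z)) => a b _.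
exact: slope_le_radius.
Qed.

(** The strict inequality [a * mdist z w < `|u w - u z|], with [w] in the open
    ball around [z], persists for [z'] near [z]: the slope is lower
    semicontinuous. *)
Lemma slope_borel e u : Lipschitz u -> borel_fun (slope e u).
Proof.
move=> [K Ku]; apply: lsc_borel_fun => a.
have [a0|a0] := ltP a 0%R.
  rewrite (_ : [set _ | _] = setT); first exact: openT.
  apply/seteqP; split => // z _; apply: lt_le_trans (slope_ge0 e u z).
  by rewrite lte_fin.
rewrite openE => z /=; rewrite lt_max lte_fin (le_gtF a0)/= => /ereal_sup_gt.
move=> [_ [w [zw wz] <-]]; rewrite lte_fin.
have d0 : (0 < mdist z w)%R by rewrite mdist_gt0 eq_sym; exact/eqP.
rewrite ballEmdist/= in zw.
rewrite ltr_pdivlMr// -subr_gt0 => F0.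
set F := (_ - _)%R in F0.
pose k := (`|K| + a + 1)%R.
have k0 : (0 < k)%R by rewrite /k ltr_wpDl// addr_ge0.
apply/nbhs_ballP; exists (Num.min (Num.min (e - mdist z w) (mdist z w)) (F / k))%R.
  by rewrite /= !lt_min subr_gt0 zw d0 divr_gt0.
move=> z'; rewrite ballEmdist/= !lt_min => /andP[/andP[z'1 z'2] z'3].
rewrite ltr_pdivlMr// in z'3.
have t1 := metric_triangle z' z w; have t2 := metric_triangle z z' w.
rewrite (metric_sym z' z) in t1.
have d'0 : (0 < mdist z' w)%R by lra.
rewrite lt_max lte_fin (le_gtF a0)/=.
apply: (@lt_le_trans _ _ (`|u w - u z'| / mdist z' w)%:E).
  rewrite lte_fin ltr_pdivlMr//.
  have h1 : (`|u w - u z| <= `|u w - u z'| + K * mdist z z')%R.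
    have := Ku z z'; have := ler_normD (u w - u z')%R (u z' - u z)%R.
    by rewrite subrKA (distrC (u z')); lra.
  have h2 : (a * mdist z' w <= a * (mdist z w + mdist z z'))%R.
    by rewrite ler_wpM2l//; lra.
  have h3 : (K * mdist z z' <= `|K| * mdist z z')%R.
    by rewrite ler_wpM2r ?mdist_ge0// ler_norm.
  rewrite /k in z'3; have := mdist_ge0 z z'; rewrite /F in z'3.
  by rewrite mulrDr in h2; rewrite !mulrDr in z'3; lra.
apply: ereal_sup_ubound; exists w => //; split.
  by rewrite ballEmdist/=; lra.
by move=> wz'; rewrite wz' mdistxx ltxx in d'0.
Qed.

Lemma lip_borel u : Lipschitz u -> borel_fun (lip u).
Proof.
move=> hu; apply: (emeasurable_fun_cvg (T := borelType)
    (fun n : nat => slope (n.+1%:R^-1)%R u) (lip u)).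
  by move=> n; exact: slope_borel.
by move=> z _; exact: slope_cvg_lip.
Qed.

(** The balls defining the slope are open, whence the smaller steps. *)
Lemma slope_trapezoid e u z w : (mdist z w <= e / 2)%R -> (0 < e)%R ->
  `|u z - u w|%:E <= trapezoid (slope e u) z w.
Proof.
move=> zwe e0; have zw : (mdist z w < e)%R by lra.
have zw' : (mdist w z < e)%R by rewrite metric_sym.
have h1 := slope_ge e u z w zw; have h2 := slope_ge e u w z zw'.
rewrite distrC metric_sym in h2.
have -> : trapezoid (slope e u) z w = (2^-1)%:E *
    (slope e u z * (mdist z w)%:E + slope e u w * (mdist z w)%:E).
  by rewrite /trapezoid -ge0_muleDl ?slope_ge0// muleAC muleC.
apply: (@le_trans _ _ ((2^-1)%:E * (`|u z - u w|%:E + `|u z - u w|%:E))).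
  by rewrite -EFinD -EFinM lee_fin; lra.
by rewrite lee_wpmul2l ?lee_fin// leeD.
Qed.

End Slope.

Section SlopeIntegral.
Context {R : realType} {X : pmetricType R}.
Local Notation borelType := (g_sigma_algebraType (@open X)).
Variables (mu : {measure set borelType -> \bar R}) (p : R).
Hypotheses (mufin : mu setT < +oo) (p1 : (1 <= p)%R).

Lemma integral_slope_cvg (u : X -> R) : Lipschitz u ->
  \int[mu]_z (slope (n.+1%:R^-1)%R u z `^ p) @[n --> \oo] -->
  \int[mu]_z (lip u z `^ p).
Proof.
move=> hu; have [K Ku] := hu.
have p0 : (0 < p)%R by exact: lt_le_trans ltr01 p1.
have msl n : measurable_fun (setT : set borelType) (slope (n.+1%:R^-1)%R u).
  exact: slope_borel.
have sK n z : slope (n.+1%:R^-1)%R u z <= `|K|%:E.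
  apply: slope_le => // w _; apply: le_trans (Ku z w) _.
  by rewrite ler_wpM2r ?mdist_ge0// ler_norm.
have sfin n z : slope (n.+1%:R^-1)%R u z \is a fin_num.
  by rewrite ge0_fin_numE ?slope_ge0// (le_lt_trans (sK n z))// ltry.
have lfin z : lip u z \is a fin_num.
  rewrite ge0_fin_numE ?lip_ge0//; apply: le_lt_trans (ltry `|K|).
  by apply: le_trans (sK 0%N z); apply: lip_le_slope; rewrite invr_gt0.
have mlip : measurable_fun (setT : set borelType) (lip u) by exact: lip_borel.
have := @dominated_convergence _ _ _ mu setT measurableT
  (fun n z => slope (n.+1%:R^-1)%R u z `^ p) (fun z => lip u z `^ p)
  (cst (`|K| `^ p)%:E).
case=> //.
- by move=> n; apply: (measurableT_comp (measurable_poweR p)).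
- by apply: (measurableT_comp (measurable_poweR p)).
- apply: aeW => z _.
  rewrite -(fineK (lfin z)) poweR_EFin.
  under eq_fun do rewrite -(fineK (sfin _ z)) poweR_EFin.
  apply: cvg_EFin; first exact: nearW.
  apply: cvg_powR => //; first by rewrite fine_ge0// lip_ge0.
    by move=> n; rewrite fine_ge0// slope_ge0.
  by apply: fine_cvg; rewrite fineK//; exact: slope_cvg_lip.
- apply/integrableP; split => //.
  under eq_integral do rewrite gee0_abs ?lee_fin ?powR_ge0//.
  by rewrite integral_cst// lte_mul_pinfty ?lee_fin ?powR_ge0.
- apply: aeW => z n _; rewrite gee0_abs ?poweR_ge0//.
  rewrite -(fineK (sfin n z)) poweR_EFin lee_fin.
  apply: ge0_ler_powR; rewrite ?nnegrE ?(ltW p0)// ?fine_ge0 ?slope_ge0//.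
  by rewrite -lee_fin fineK.
Qed.

Lemma le_integral_lip (u h : X -> R) e : Lipschitz u -> Lipschitz h ->
  (forall z, (0 <= h z)%R) -> (0 < e)%R ->
  (forall z w, (mdist z w <= e)%R -> (`|u z - u w| <= h z * mdist z w)%R) ->
  \int[mu]_z (lip u z `^ p) <= \int[mu]_z (h z `^ p)%:E.
Proof.
move=> hu hh h0 e0 uh; have p0 : (0 < p)%R by exact: lt_le_trans ltr01 p1.
have mlip : measurable_fun (setT : set borelType) (lip u) by exact: lip_borel.
apply: ge0_le_integral => //.
- by move=> z _; exact: poweR_ge0.
- by apply: (measurableT_comp (measurable_poweR p)).
- apply/measurable_EFinP.
  by apply: (measurableT_comp (measurable_powR p)); exact: Lipschitz_borel.
- move=> z _; rewrite -poweR_EFin; apply: gt0_ler_poweR; rewrite ?(ltW p0)//.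
  + by rewrite in_itv/= lip_ge0 leey.
  + by rewrite in_itv/= lee_fin h0 leey.
  + apply: le_trans (lip_le_slope e u z e0) _; apply: slope_le => // w zw.
    by apply: uh; exact: ltW.
Qed.

End SlopeIntegral.

(** * The chain modulus *)

Section ChainIntegralAlgebra.
Context {R : realType} {X : pmetricType R}.
Implicit Types (c : @chain R X) (g : X -> \bar R).

Lemma le_eps_chains a b : (a <= b)%R -> @eps_chains R X a `<=` eps_chains b.
Proof. by move=> ab c ca i ic; apply: le_trans (ca i ic) ab. Qed.

Lemma le_chain_integral g g' c : (forall z, 0 <= g z) ->
  (forall z, g z <= g' z) -> chain_integral g c <= chain_integral g' c.
Proof.
move=> g0 gg'; apply: lee_sum => i _.
rewrite lee_wpmul2r ?lee_fin ?mdist_ge0// lee_wpmul2r ?lee_fin//.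
by rewrite leeD.
Qed.

Lemma chain_integralZ (k : R) g c : (0 <= k)%R -> (forall z, 0 <= g z) ->
  chain_integral (fun z => k%:E * g z) c = k%:E * chain_integral g c.
Proof.
move=> k0 g0; rewrite /chain_integral ge0_sume_distrr; last first.
  by move=> i _; exact: trapezoid_ge0.
by apply: eq_bigr => i _; rewrite -ge0_muleDr// !muleA.
Qed.

Lemma chain_integral_cst (k : R) c :
  chain_integral (cst k%:E) c = (k * chain_length c)%:E.
Proof.
rewrite /chain_integral /chain_length mulr_sumr -sumEFin.
by apply: eq_bigr => i _; rewrite -EFinD -!EFinM; congr EFin; field.
Qed.

Lemma trivial_chain (e : R) (x : X) : (0 < e)%R ->
  (chains_from_to x x `&` eps_chains e) (x, [::]).
Proof. by move=> e0; do 2?split => //; exists e. Qed.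

Lemma chain_integral_trivial g (x : X) : chain_integral g (x, [::]) = 0.
Proof. by rewrite /chain_integral big_ord0. Qed.

End ChainIntegralAlgebra.

Section ChainModulus.
Context {R : realType} {X : pmetricType R}.
Local Notation borelType := (g_sigma_algebraType (@open X)).
Variables (mu : {measure set borelType -> \bar R}) (p : R) (x y : X).
Hypotheses (mufin : mu setT < +oo) (p1 : (1 <= p)%R).

Lemma chain_mod_nondecreasing (C : set (@chain R X)) F (mu' : set X -> \bar R) a b :
  (a <= b)%R -> chain_mod p a C F mu' <= chain_mod p b C F mu'.
Proof.
move=> ab; apply: le_ereal_inf_tmp => _ [rho [Frho rho0 mrho adm] <-].
apply: ereal_inf_lbound; exists rho => //; split => // c [Cc ca].
by apply: adm; split => //; exact: le_eps_chains ca.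
Qed.

Lemma lim_chain_mod (C : set (@chain R X)) F (mu' : set X -> \bar R) :
  lim ((fun e : R => chain_mod p e C F mu') @ 0^'+) =
  ereal_inf [set chain_mod p e C F mu' | e in [set e : R | (0 < e)%R]].
Proof.
by apply: lim_at_right0_inf => a b _; exact: chain_mod_nondecreasing.
Qed.

Lemma Lip_family_fin_at (rho : X -> \bar R) : Lip_family rho ->
  (forall z, 0 <= rho z) -> fin_at_borel x y rho.
Proof.
move=> [f hf <-] f0; split => //=; rewrite ?ltry//.
by apply/measurable_EFinP; exact: Lipschitz_borel.
Qed.

(** Both limits are infima over the scale, so the loss of scale in
    [lipschitz_admissible_approx] is harmless. *)
Lemma lim_chain_mod_Lip :
  lim ((fun e : R => chain_mod p e (chains_from_to x y)
          (fin_at_borel x y) (mu : set X -> \bar R)) @ 0^'+) =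
  lim ((fun e : R => chain_mod p e (chains_from_to x y)
          Lip_family (mu : set X -> \bar R)) @ 0^'+).
Proof.
rewrite !lim_chain_mod; apply/eqP; rewrite eq_le; apply/andP; split.
  apply: le_ereal_inf_tmp => _ [e /= e0 <-].
  apply: (@le_trans _ _ (chain_mod p e (chains_from_to x y)
          (fin_at_borel x y) (mu : set X -> \bar R))).
    by apply: ereal_inf_lbound; exists e.
  apply: ereal_inf_le_tmp => _ [rho [Frho rho0 mrho adm] <-].
  by exists rho => //; split => //; exact: Lip_family_fin_at.
apply: le_ereal_inf_tmp => _ [e /= e0 <-].
apply: le_ereal_inf_tmp => _ [rho [[mrho rho0 rhox rhoy] _ _ adm] <-].
have [->|] := eqVneq (bintegral mu setT (fun z => rho z `^ p)) +oo.
  by rewrite leey.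
rewrite -ltey => rhofin; apply/lee_addgt0Pr => theta theta0.
have [v [h [e' [[vL hL e'0 vx vy] [h0 vh hint]]]]] :=
  lipschitz_admissible_approx mu p mufin p1 x y rho e theta
    e0 theta0 mrho rho0 rhox rhoy adm rhofin.
apply: le_trans hint.
apply: (@le_trans _ _ (chain_mod p e' (chains_from_to x y) Lip_family
    (mu : set X -> \bar R))).
  by apply: ereal_inf_lbound; exists e'.
apply: ereal_inf_lbound; exists (EFin \o h) => //; split => //.
- by exists h.
- by apply/measurable_EFinP; exact: Lipschitz_borel.
- move=> c [[_ cx cy] ce].
  have := @le_chain_integral_of_step R X v (EFin \o h) e' c _ ce.
  rewrite cx cy vx vy subr0 normr1; apply => z w zw.
  rewrite /trapezoid /= -EFinD -!EFinM lee_fin.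
  have zw' : (mdist w z <= e')%R by rewrite metric_sym.
  have := vh z w zw; have := vh w z zw'.
  by rewrite distrC metric_sym; lra.
Qed.

(** An admissible Lipschitz weight is an upper gradient of its chain potential,
    which is locally Lipschitz, hence Borel, because the weight is locally
    bounded. *)
Lemma lipschitz_upper_gradient_ge (C : R) : (0 < C)%R ->
  (forall (u : X -> R) (e : R) (g : X -> \bar R),
     borel_rfun u -> (0 < e)%R -> upper_gradient e u g ->
     g x < +oo -> g y < +oo ->
     (`|u x - u y| `^ p)%:E <=
       (C * mdist x y `^ (p - 1))%:E * \int[mu]_z (g z `^ p)) ->
  (C^-1 * mdist x y `^ (1 - p))%:E <=
  lim ((fun e : R => chain_mod p e (chains_from_to x y)
          Lip_family (mu : set X -> \bar R)) @ 0^'+).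
Proof.
move=> C0 hC; rewrite lim_chain_mod.
apply: le_ereal_inf_tmp => _ [e /= e0 <-].
apply: le_ereal_inf_tmp => _ [_ [[f [K fK] <-] f0 mf adm] <-].
have [xy|xNy] := eqVneq x y.
  have := adm (x, [::]).
  rewrite chain_integral_trivial xy => /(_ (trivial_chain e y e0)).
  by rewrite lee_fin ler10.
have d0 : (0 < mdist x y)%R by rewrite mdist_gt0.
have [u [u01 ux uy ustep]] := chain_potential e x y (EFin \o f) e0 f0 adm.
have fr0 z : (0 <= f z)%R by rewrite -lee_fin; exact: f0.
have ubor : borel_rfun u.
  apply: locally_lipschitz_borel => z.
  exists (f z + `|K|)%R, (Num.min e 1)%R; split; first by rewrite lt_min e0 ltr01.
  move=> w; rewrite lt_min => /andP[zwe zw1].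
  have := ustep z w (ltW zwe).
  rewrite /trapezoid/= -EFinD -!EFinM lee_fin => /le_trans; apply.
  rewrite ler_wpM2r ?mdist_ge0//.
  have := fK z w; rewrite ler_norml => /andP[+ _].
  have : (K * mdist z w <= `|K| * 1)%R.
    apply: (@le_trans _ _ (`|K| * mdist z w)%R).
      by rewrite ler_wpM2r ?mdist_ge0// ler_norm.
    by rewrite ler_wpM2l// ltW.
  have := normr_ge0 K; have := fr0 z; lra.
have ug : upper_gradient e u (EFin \o f).
  split => // c ce; exact: le_chain_integral_of_step ce.
have := hC u e (EFin \o f) ubor e0 ug (ltry _) (ltry _).
rewrite ux uy sub0r normrN normr1 powR1 => h1.
have dp : (0 < mdist x y `^ (p - 1))%R by rewrite powR_gt0.
rewrite -[leLHS]mule1.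
apply: (@le_trans _ _ ((C^-1 * mdist x y `^ (1 - p))%:E *
  ((C * mdist x y `^ (p - 1))%:E * \int[mu]_z ((EFin \o f) z `^ p)))).
  by rewrite lee_wpmul2l// lee_fin mulr_ge0 ?invr_ge0 ?powR_ge0// ltW.
rewrite muleA -EFinM.
have -> : (C^-1 * mdist x y `^ (1 - p) * (C * mdist x y `^ (p - 1)) = 1)%R.
  rewrite mulrACA mulVf ?gt_eqF// mul1r -powRD.
    by rewrite addrC subrKA subrr powRr0.
  by rewrite (gt_eqF d0) implybT.
by rewrite mul1e.
Qed.

End ChainModulus.

(** * Short chains and the pointwise inequality *)

Lemma poweRD_le {R : realType} (p l : R) (a : \bar R) :
  (0 < p)%R -> (0 <= l)%R -> 0 <= a ->
  (a + l%:E) `^ p <= (2 `^ p)%:E * (a `^ p + (l `^ p)%:E).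
Proof.
move=> p0 l0; case: a => [a| |]//; last first.
  move=> _; rewrite [_ `^ p in leRHS]poweRyr ?gt_eqF// addye//.
  by rewrite gt0_muley ?leey// lte_fin powR_gt0.
rewrite lee_fin => a0; rewrite -EFinD !poweR_EFin -EFinD -EFinM lee_fin.
have main b : (0 <= b)%R -> (a + l <= 2 * b)%R ->
    ((a + l) `^ p <= 2 `^ p * b `^ p)%R.
  move=> b0 alb; rewrite -powRM//.
  by apply: ge0_ler_powR; rewrite ?nnegrE ?(ltW p0)//; lra.
have ap := powR_ge0 a p; have lp := powR_ge0 l p.
have [al|la] := leP a l.
  apply: le_trans (main l l0 _) _; first by lra.
  by rewrite ler_pM2l ?powR_gt0// lerDr.
apply: le_trans (main a a0 _) _; first by lra.
by rewrite ler_pM2l ?powR_gt0// lerDl.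
Qed.

Section ShortChains.
Context {R : realType} {X : pmetricType R}.
Local Notation borelType := (g_sigma_algebraType (@open X)).
Variables (mu : {measure set borelType -> \bar R}) (p : R) (x y : X).
Hypotheses (mufin : mu setT < +oo) (p1 : (1 <= p)%R).

Definition short_chain_inf (C : R) (g : X -> \bar R) (e : R) : \bar R :=
  ereal_inf [set chain_integral g c `^ p | c in
    [set c | [/\ chains_from_to x y c, eps_chains e c &
                 (chain_length c <= C * mdist x y)%R]]].

Lemma lim_short_chain_inf (C : R) (g : X -> \bar R) :
  lim (short_chain_inf C g @ 0^'+) =
  ereal_sup [set short_chain_inf C g e | e in [set e : R | (0 < e)%R]].
Proof.
apply: lim_at_right0_sup => a b _ ab; apply: ereal_inf_le_tmp => _ [c [cxy ca cl] <-].
by exists c => //; split => //; exact: le_eps_chains ca.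
Qed.

Lemma short_chain_inf_diag (C : R) (g : X -> \bar R) : x = y ->
  lim (short_chain_inf C g @ 0^'+) <= 0.
Proof.
move=> xy; rewrite lim_short_chain_inf; apply: ge_ereal_sup => _ [e /= e0 <-].
apply: ereal_inf_lbound; exists (x, [::]).
  have [cxx ce] := trivial_chain e x e0; split => //; first by rewrite -xy.
  by rewrite /chain_length big_ord0 -xy mdistxx mulr0.
rewrite chain_integral_trivial poweR0r// gt_eqF//; exact: lt_le_trans ltr01 p1.
Qed.

(** If the infimum over short chains exceeded its bound at some scale, then
    every chain from [x] to [y] at that scale would be expensive for [g + l]:
    short ones because of [g], long ones because of [l]. So [g + l] would be
    admissible after division by [A], and the Lipschitz function approximating
    its potential would violate the hypothesis. With [l ^ p] comparable to the
    energy of [g], the energy of [g + l] is at most a constant multiple of that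
    of [g]; the constants [Q] and [C'] record this multiple. *)
Lemma short_chain_inf_le (C : R) : (0 < C)%R ->
  (forall u : X -> R, Lipschitz u -> (`|u x - u y| `^ p)%:E <=
     (C * mdist x y `^ (p - 1))%:E * \int[mu]_z (lip u z `^ p)) ->
  exists C' : R, (0 < C')%R /\ forall g : X -> \bar R,
    borel_fun g -> (forall z, 0 <= g z) -> g x < +oo -> g y < +oo ->
    lim (short_chain_inf C' g @ 0^'+) <=
      (C' * mdist x y `^ (p - 1))%:E * \int[mu]_z (g z `^ p).
Proof.
move=> C0 hC; have p0 : (0 < p)%R by exact: lt_le_trans ltr01 p1.
have [xy|xNy] := eqVneq x y.
  exists 1%R; split => // g _ _ _ _; apply: le_trans (short_chain_inf_diag 1 g xy) _.
  rewrite mule_ge0//; first by rewrite lee_fin mulr_ge0// powR_ge0.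
  by apply: integral_ge0 => z _; exact: poweR_ge0.
set d := mdist x y; have d0 : (0 < d)%R by rewrite mdist_gt0.
have dp0 : (0 < d `^ (p - 1))%R by rewrite powR_gt0.
pose W := fine (mu setT).
have WE : mu setT = W%:E by rewrite fineK// ge0_fin_numE.
have W0 : (0 <= W)%R by rewrite fine_ge0.
have W1 : (0 < 1 + W)%R by lra.
clearbody W.
pose Q := (C * d `^ (p - 1) * (2 * (2 `^ p * (1 + W))))%R.
have Q0 : (0 < Q)%R.
  by rewrite /Q !mulr_gt0 ?powR_gt0//; lra.
pose C' := (1 + (Q + 1) / d `^ (p - 1) + (Q + 1) / d)%R.
have [Qd Qd'] : (0 < (Q + 1) / d `^ (p - 1) /\ 0 < (Q + 1) / d)%R.
  by split; rewrite divr_gt0//; lra.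
have C'1 : (1 <= C')%R by rewrite /C'; lra.
have C'Q : (Q + 1 <= C' * d `^ (p - 1))%R.
  by rewrite -ler_pdivrMr// /C'; lra.
have C'Q' : (Q + 1 <= (C' * d) `^ p)%R.
  have h : (Q + 1 <= C' * d)%R by rewrite -ler_pdivrMr// /C'; lra.
  apply: le_trans h _; rewrite -[leLHS]powRr1; last by rewrite mulr_ge0 ?ltW//; lra.
  apply: ler_powR => //; apply: le_trans (_ : Q + 1 <= _)%R; first by lra.
  by rewrite -ler_pdivrMr// /C'; lra.
exists C'; split; first by lra.
move=> g mg g0 gx gy; rewrite lim_short_chain_inf.
apply: ge_ereal_sup => _ [e /= e0 <-].
have C'd0 : (0 < C' * d `^ (p - 1))%R by lra.
have [->|] := eqVneq (\int[mu]_z (g z `^ p)) +oo.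
  by rewrite gt0_muley ?lte_fin// leey.
rewrite -ltey => gfin.
have gfin' : \int[mu]_z (g z `^ p) \is a fin_num.
  by rewrite ge0_fin_numE// integral_ge0// => z _; exact: poweR_ge0.
set G := fine (\int[mu]_z (g z `^ p)).
have GE : \int[mu]_z (g z `^ p) = G%:E by rewrite fineK.
have G0 : (0 <= G)%R by apply: fine_ge0; apply: integral_ge0 => z _; exact: poweR_ge0.
rewrite GE -EFinM; apply/lee_addgt0Pr => del del0.
(* replacing the energy by a slightly larger one makes it positive *)
pose G' := (G + del / (C' * d `^ (p - 1)))%R.
have G'0 : (G < G')%R by rewrite ltrDl divr_gt0.
have -> : (C' * d `^ (p - 1) * G)%:E + del%:E = (C' * d `^ (p - 1) * G')%:E.
  by rewrite -EFinD /G'; congr EFin; field; rewrite !gt_eqF//; lra.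
rewrite leNgt; apply/negP => Ibig.
pose l := (G' `^ p^-1)%R; pose A := (((Q + 1) * G') `^ p^-1)%R.
have G'pos : (0 < G')%R by exact: le_lt_trans G'0.
have QG' : (0 < (Q + 1) * G')%R by rewrite mulr_gt0//; lra.
have l0 : (0 < l)%R by rewrite powR_gt0.
have A0 : (0 < A)%R by rewrite powR_gt0.
have lp : (l `^ p = G')%R by rewrite -powRrM mulVf ?gt_eqF// powRr1// ltW.
have Ap : (A `^ p = (Q + 1) * G')%R by rewrite -powRrM mulVf ?gt_eqF// powRr1// ltW.
clearbody l A G'.
have Ainv0 : (0 <= A^-1)%R by rewrite invr_ge0 ltW.
pose gl z := g z + l%:E.
have gl0 z : 0 <= gl z by rewrite adde_ge0// lee_fin ltW.
have mgl : borel_fun gl by exact: emeasurable_funD.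
(* a chain through which g + l has small integral is short for the weight l
   and cheap for g, against the choice of A *)
have glA c : chains_from_to x y c -> eps_chains e c -> A%:E <= chain_integral gl c.
  move=> cxy ce; rewrite leNgt; apply/negP => cA.
  have gcA : chain_integral g c < A%:E.
    apply: le_lt_trans cA; apply: le_chain_integral => // z.
    by rewrite leeDl// lee_fin ltW.
  have lcA : (l * chain_length c < A)%R.
    rewrite -lte_fin -chain_integral_cst; apply: le_lt_trans cA.
    apply: le_chain_integral => z; first by rewrite lee_fin ltW.
    by rewrite leeDr.
  have cshort : (chain_length c <= C' * d)%R.
    rewrite -(ler_pM2l l0); apply: le_trans (ltW lcA) _.
    rewrite leNgt; apply/negP => lA.
    have Cd0 : (0 <= C' * d)%R by rewrite mulr_ge0 ?(ltW d0)//; lra.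
    have : ((l * (C' * d)) `^ p < A `^ p)%R.
      by apply: gt0_ltr_powR => //; rewrite nnegrE ?(ltW A0)// (mulr_ge0 (ltW l0)).
    by rewrite Ap powRM ?(ltW l0)// lp mulrC ltr_pM2r// ltNge C'Q'.
  have : short_chain_inf C' g e <= (A `^ p)%:E.
    apply: (@le_trans _ _ (chain_integral g c `^ p)).
      by apply: ereal_inf_lbound; exists c.
    rewrite -poweR_EFin; apply: gt0_ler_poweR; rewrite ?(ltW p0)// ?in_itv/=.
    - by rewrite chain_integral_ge0// leey.
    - by rewrite lee_fin (ltW A0) leey.
    - exact: ltW.
  rewrite Ap => /(lt_le_trans Ibig); rewrite lte_fin ltr_pM2r// ltNge.
  by rewrite C'Q.
pose rho z := (A^-1)%:E * gl z.
have rho0 z : 0 <= rho z by rewrite mule_ge0.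
have mrho : borel_fun rho by exact: measurable_funeM.
have adm c : (chains_from_to x y `&` eps_chains e) c -> 1 <= chain_integral rho c.
  move=> [cxy ce]; rewrite chain_integralZ//.
  apply: (@le_trans _ _ ((A^-1)%:E * A%:E)).
    by rewrite -EFinM mulVf ?gt_eqF.
  by rewrite lee_wpmul2l// glA.
pose S := (A^-1 `^ p * (2 `^ p * ((1 + W) * G')))%R.
have S0 : (0 < S)%R.
  by do 3?[apply: mulr_gt0 => //]; rewrite powR_gt0 ?invr_gt0.
have mgp : measurable_fun (setT : set borelType) (fun z => g z `^ p).
  exact: (measurableT_comp (measurable_poweR p)).
have rhoS : \int[mu]_z (rho z `^ p) <= S%:E.
  apply: (@le_trans _ _ (\int[mu]_z ((A^-1 `^ p * 2 `^ p)%:E *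
      (g z `^ p + (l `^ p)%:E)))).
    apply: ge0_le_integral => //.
    - by move=> z _; exact: poweR_ge0.
    - exact: (measurableT_comp (measurable_poweR p)).
    - by apply: measurable_funeM; exact: emeasurable_funD.
    - move=> z _; rewrite /rho poweRM// poweR_EFin EFinM -muleA.
      by rewrite lee_wpmul2l ?lee_fin ?powR_ge0// poweRD_le// ltW.
  rewrite ge0_integralZl//; first last.
  - by rewrite lee_fin mulr_ge0 ?powR_ge0.
  - by move=> z _; rewrite adde_ge0 ?poweR_ge0// lee_fin powR_ge0.
  - exact: emeasurable_funD.
  rewrite ge0_integralD//; [|by move=> z _; exact: poweR_ge0|
    by move=> z _; rewrite lee_fin powR_ge0].
  rewrite integral_cst// GE [mu _]WE -EFinM lee_fin /S lp.
  rewrite -mulrA !ler_pM2l ?powR_gt0 ?invr_gt0//; move: G'0; lra.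
have rhox : rho x < +oo.
  by rewrite /rho lte_mul_pinfty ?lee_fin// lte_add_pinfty ?ltry.
have rhoy : rho y < +oo.
  by rewrite /rho lte_mul_pinfty ?lee_fin// lte_add_pinfty ?ltry.
have rhofin : \int[mu]_z (rho z `^ p) < +oo by apply: le_lt_trans rhoS (ltry _).
have [v [h [e' [[vL hL e'0 vx vy] [h0 vh hint]]]]] :=
  lipschitz_admissible_approx mu p mufin p1 x y rho e S
    e0 S0 mrho rho0 rhox rhoy adm rhofin.
have := hC v vL; rewrite vx vy sub0r normrN normr1 powR1 => v1.
(* the error allowed in the approximation equals the bound [S] on the energy,
   and the factor 2 in [Q] absorbs it *)
have : 1 <= (C * d `^ (p - 1) * (S + S))%:E.
  apply: le_trans v1 _; rewrite [leRHS]EFinM.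
  rewrite lee_wpmul2l ?lee_fin ?mulr_ge0 ?(ltW dp0) ?(ltW C0)//.
  apply: le_trans (le_integral_lip mu p p1 v h e' vL hL h0 e'0 vh) _.
  by apply: le_trans hint _; rewrite EFinD leeD2r.
rewrite lee_fin leNgt => /negP; apply.
have -> : (C * d `^ (p - 1) * (S + S) = Q / (Q + 1))%R.
  have AV : (A^-1 `^ p = ((Q + 1) * G')^-1)%R.
    rewrite -Ap -powR_inv1 ?(ltW A0)// -powRrM mulN1r -mulrN1 powRrM.
    by rewrite powR_inv1// powR_ge0.
  by rewrite /S AV /Q; field; rewrite !gt_eqF//; rewrite -/Q; lra.
by rewrite ltr_pdivrMr; lra.
Qed.

(** The slope of [u] at scale [e], divided by [`|u x - u y|], is admissible for
    chains with steps at most [e / 2]; it decreases to the local Lipschitz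
    constant as [e] tends to [0]. *)
Lemma lip_inequality_of_chain_mod (c : R) : (0 < c)%R ->
  (c * mdist x y `^ (1 - p))%:E <=
    lim ((fun e : R => chain_mod p e (chains_from_to x y)
          (fin_at_borel x y) (mu : set X -> \bar R)) @ 0^'+) ->
  forall u : X -> R, Lipschitz u -> (`|u x - u y| `^ p)%:E <=
     (c^-1 * mdist x y `^ (p - 1))%:E * \int[mu]_z (lip u z `^ p).
Proof.
move=> c0; rewrite lim_chain_mod => hmod u hu.
have p0 : (0 < p)%R by exact: lt_le_trans ltr01 p1.
have rhs0 : 0 <= (c^-1 * mdist x y `^ (p - 1))%:E * \int[mu]_z (lip u z `^ p).
  rewrite mule_ge0//; first by rewrite lee_fin mulr_ge0 ?invr_ge0 ?(ltW c0) ?powR_ge0.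
  by apply: integral_ge0 => z _; exact: poweR_ge0.
have [uxy|uxy] := eqVneq (u x) (u y).
  by rewrite uxy subrr normr0 powR0 ?gt_eqF.
have d0 : (0 < mdist x y)%R.
  by rewrite mdist_gt0; apply: contra uxy => /eqP ->.
set D := `|u x - u y|%R; have D0 : (0 < D)%R by rewrite normr_gt0 subr_eq0.
have [K Ku] := hu.
have mod_le n : (c * mdist x y `^ (1 - p))%:E <=
    (D^-1 `^ p)%:E * \int[mu]_z (slope (n.+1%:R^-1)%R u z `^ p).
  set e : R := (n.+1%:R^-1)%R; have e0 : (0 < e)%R by rewrite invr_gt0.
  pose rho z := (D^-1)%:E * slope e u z.
  have rho0 z : 0 <= rho z by rewrite mule_ge0 ?slope_ge0// lee_fin invr_ge0 ltW.
  have mrho : borel_fun rho by apply: measurable_funeM; exact: slope_borel.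
  have rhofin z : rho z < +oo.
    rewrite lte_mul_pinfty ?lee_fin ?invr_ge0 ?(ltW D0)//.
    apply: le_lt_trans (ltry `|K|); apply: slope_le => // w _.
    by apply: le_trans (Ku z w) _; rewrite ler_wpM2r ?mdist_ge0// ler_norm.
  have adm c' : (chains_from_to x y `&` eps_chains (e / 2)) c' ->
      1 <= chain_integral rho c'.
    move=> [[_ c'x c'y] ce].
    rewrite chain_integralZ ?invr_ge0 ?(ltW D0)//; last by move=> z; exact: slope_ge0.
    have := @le_chain_integral_of_step R X u (slope e u) (e / 2)%R c' _ ce.
    rewrite c'x c'y distrC -/D => H.
    apply: (@le_trans _ _ ((D^-1)%:E * D%:E)); first by rewrite -EFinM mulVf ?gt_eqF.
    rewrite lee_wpmul2l ?lee_fin ?invr_ge0 ?(ltW D0)//; apply: H => z w zw.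
    exact: slope_trapezoid.
  apply: le_trans hmod _.
  apply: (@le_trans _ _ (chain_mod p (e / 2)%R (chains_from_to x y)
      (fin_at_borel x y) (mu : set X -> \bar R))).
    by apply: ereal_inf_lbound; exists (e / 2)%R => //=; rewrite divr_gt0.
  apply: (@le_trans _ _ (\int[mu]_z (rho z `^ p))).
    apply: ereal_inf_lbound; exists rho => //; split => //; split => //.
  rewrite -ge0_integralZl//.
  - apply: ge0_le_integral => //.
    + by move=> z _; exact: poweR_ge0.
    + exact: (measurableT_comp (measurable_poweR p)).
    + apply: measurable_funeM; apply: (measurableT_comp (measurable_poweR p)).
      exact: slope_borel.
    + move=> z _; rewrite /rho poweRM ?poweR_EFin ?slope_ge0//.
      by rewrite lee_fin invr_ge0 ltW.
  - by apply: (measurableT_comp (measurable_poweR p)); exact: slope_borel.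
  - by move=> z _; exact: poweR_ge0.
  - by rewrite lee_fin powR_ge0.
have lim_le : (c * mdist x y `^ (1 - p))%:E <=
    (D^-1 `^ p)%:E * \int[mu]_z (lip u z `^ p).
  have Dfin : (D^-1 `^ p)%:E \is a fin_num by [].
  have icvg := integral_slope_cvg mu p mufin p1 u hu.
  have := cvgeZl Dfin icvg => /cvg_lim <-//.
  apply: lime_ge; last exact: nearW.
  by apply/cvg_ex; eexists; exact: cvgeZl Dfin icvg.
set I := \int[mu]_z _ in lim_le *.
have Dp : (0 < D `^ p)%R by rewrite powR_gt0.
have DV : (D `^ p * D^-1 `^ p = 1)%R.
  by rewrite -powRM ?invr_ge0 ?(ltW D0)// mulfV ?gt_eqF// powR1.
have dV : (mdist x y `^ (p - 1) * mdist x y `^ (1 - p) = 1)%R.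
  rewrite -powRD; first by rewrite addrC subrKA subrr powRr0.
  by rewrite (gt_eqF d0) implybT.
have k0 : (0 <= D `^ p * (c^-1 * mdist x y `^ (p - 1)))%R.
  by rewrite !mulr_ge0 ?powR_ge0// invr_ge0 ltW.
have := lee_wpmul2l (_ : 0 <= (D `^ p * (c^-1 * mdist x y `^ (p - 1)))%:E) lim_le.
rewrite lee_fin => /(_ k0); rewrite muleA -!EFinM.
have -> : (D `^ p * (c^-1 * mdist x y `^ (p - 1)) * (c * mdist x y `^ (1 - p)) =
    D `^ p * (c^-1 * c) * (mdist x y `^ (p - 1) * mdist x y `^ (1 - p)))%R by ring.
rewrite dV mulVf ?gt_eqF// !mulr1.
have -> : (D `^ p * (c^-1 * mdist x y `^ (p - 1)) * D^-1 `^ p =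
    (D `^ p * D^-1 `^ p) * (c^-1 * mdist x y `^ (p - 1)))%R by ring.
by rewrite DV mul1r.
Qed.

End ShortChains.

(** * Equivalence of the four conditions *)

Lemma riesz_measure_finite {R : realType} {X : pmetricType R}
    (m : {outer_measure set X -> \bar R}%R) (L : R) (x y : X) :
  metric_measure_space m -> doubling m ->
  exists N : {measure set (g_sigma_algebraType (@open X)) -> \bar R},
    (N : set X -> \bar R) = riesz_measure m L x y /\ N setT < +oo.
Proof.
move=> hm [CD [CD1 hdbl]].
have [M ME] := measure_of_caratheodory m (radon_borel (mms_radon hm)).
have Mnontriv : M setT != 0.
  by have := mms_nontrivial hm; rewrite -ME.
have Mfin (z : X) r : M (ball z r) < +oo.
  by rewrite [M _](congr1 (@^~ (ball z r)) ME); apply: (mms_bounded hm); exists z, r.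
have Mdbl (z : X) r : (0 < r)%R -> M (ball z (2 * r)%R) <= CD%:E * M (ball z r).
  by have := hdbl z r; rewrite -ME.
have mk := measurable_riesz_kernel M Mnontriv Mfin CD Mdbl L x y.
have k0 := riesz_kernel_ge0 M Mnontriv Mfin CD Mdbl L x y.
have [N NE] := measure_with_density _ _ _ M _ mk k0.
exists N; split.
  by rewrite NE /riesz_measure -ME.
rewrite [N _](congr1 (@^~ setT) NE).
exact: (integral_riesz_kernel_lty M Mnontriv Mfin CD CD1 Mdbl L x y).
Qed.

Theorem corollary7p10 (R : realType) (p : R) (hp : (1 <= p)%R)
    (X : pmetricType R) (m : {outer_measure set X -> \bar R}%R)
    (hm : metric_measure_space m) (hdoubling : doubling m) (x y : X) :
  [<->
   (exists C L : R, [/\ (0 < C)%R, (1 <= L)%R &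
      forall u : X -> R, Lipschitz u ->
        (`|u x - u y| `^ p)%:E <=
          (C * mdist x y `^ (p - 1))%:E *
          bintegral (riesz_measure m L x y) setT (fun z => lip u z `^ p)]) ;
   (exists C L : R, [/\ (0 < C)%R, (1 <= L)%R &
      forall g : X -> \bar R, borel_fun g -> (forall z, 0 <= g z) ->
        g x < +oo -> g y < +oo ->
        lim ((fun e : R => ereal_inf
               [set chain_integral g c `^ p | c in
                  [set c | [/\ chains_from_to x y c, eps_chains e c &
                     (chain_length c <= C * mdist x y)%R]]]) @ 0^'+) <=
          (C * mdist x y `^ (p - 1))%:E *
          bintegral (riesz_measure m L x y) setT (fun z => g z `^ p)]) ;
   (exists C L : R, [/\ (0 < C)%R, (1 <= L)%R &
      forall (u : X -> R) (e : R) (g : X -> \bar R),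
        borel_rfun u -> (0 < e)%R -> upper_gradient e u g ->
        g x < +oo -> g y < +oo ->
        (`|u x - u y| `^ p)%:E <=
          (C * mdist x y `^ (p - 1))%:E *
          bintegral (riesz_measure m L x y) setT (fun z => g z `^ p)]) ;
   (exists c L : R, [/\ (0 < c)%R, (1 <= L)%R,
      lim ((fun e : R => chain_mod p e (chains_from_to x y)
              (fin_at_borel x y) (riesz_measure m L x y)) @ 0^'+) =
      lim ((fun e : R => chain_mod p e (chains_from_to x y)
              Lip_family (riesz_measure m L x y)) @ 0^'+) &
      (c * mdist x y `^ (1 - p))%:E <=
      lim ((fun e : R => chain_mod p e (chains_from_to x y)
              Lip_family (riesz_measure m L x y)) @ 0^'+)])].
Proof.
  (* your proof *)
Proof.
have p0 : (0 < p)%R by exact: lt_le_trans ltr01 hp.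
tfae.
- move=> [C [L [C0 L1 hC]]].
  have [N [NE Nfin]] := riesz_measure_finite m L x y hm hdoubling.
  rewrite -NE in hC.
  have [C' [C'0 hC']] := short_chain_inf_le N p x y Nfin hp C C0 hC.
  by exists C', L; split => //; rewrite -NE.
- move=> [C [L [C0 L1 hC]]]; exists C, L; split => // u e g mu_ e0 ug gx gy.
  have [mg g0 hug] := ug; apply: le_trans (hC g mg g0 gx gy).
  rewrite -/(short_chain_inf p x y C g) lim_short_chain_inf.
  apply: (@le_trans _ _ (short_chain_inf p x y C g e)); last first.
    by apply: ereal_sup_ubound; exists e.
  apply: le_ereal_inf_tmp => _ [c [[_ cx cy] ce _] <-].
  rewrite -poweR_EFin; apply: gt0_ler_poweR;
    rewrite ?(ltW p0)// ?in_itv/= ?leey ?andbT.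
  + by rewrite lee_fin.
  + exact: chain_integral_ge0.
  + by have := hug c ce; rewrite cx cy distrC.
- move=> [C [L [C0 L1 hC]]].
  have [N [NE Nfin]] := riesz_measure_finite m L x y hm hdoubling.
  rewrite -NE in hC; exists (C^-1)%R, L; split => //.
  + by rewrite invr_gt0.
  + by rewrite -NE; exact: lim_chain_mod_Lip.
  + by rewrite -NE; exact: lipschitz_upper_gradient_ge.
- move=> [c [L [c0 L1 modE hc]]].
  have [N [NE Nfin]] := riesz_measure_finite m L x y hm hdoubling.
  rewrite -modE -NE in hc; exists (c^-1)%R, L; split => //.
    by rewrite invr_gt0.
  by rewrite -NE; exact: lip_inequality_of_chain_mod.
Qed.
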